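(* Let $(S_n)_{n\in\mathbb N}$ be a sequence of centered real random variables, with $\mathrm{Var}(S_n)>0$, that admits uniform bounds on cumulants with parameters $(D_n,N_n,A)$. Let $Y_n=\frac{S_n}{\sqrt{\mathrm{Var}(S_n)}}$ and $(\widetilde\sigma_n)^2=\frac{\mathrm{Var}(S_n)}{N_nD_n}$, $\widetilde\sigma_n>0$. Then for all $n$ $$d_{\mathrm{Kol}}(Y_n,\mathcal N_{\mathbb R}(0,1))\le\frac{76.36\,A^3}{(\widetilde\sigma_n)^3}\sqrt{\frac{D_n}{N_n}}.$$
   Context: $d_{\mathrm{Kol}}(X,Y)=\sup_{a\in\mathbb R}|\mathbb P[X\le a]-\mathbb P[Y\le a]|$ is the Kolmogorov distance; $\mathcal N_{\mathbb R}(0,1)$ is the standard Gaussian law. The cumulants $\kappa^{(r)}(X)$ of a real random variable $X$ whose exponential generating function converges near $0$ are defined by $\log\mathbb E[e^{zX}]=\sum_{r\ge1}\frac{\kappa^{(r)}(X)}{r!}z^r$. A sequence $(S_n)$ of centered real random variables (with exponential generating functions convergent near $0$) admits uniform bounds on cumulants with parameters $(D_n,N_n,A)$ (where $D_n,N_n,A>0$) if for all $n$ and all $r\ge2$, $|\kappa^{(r)}(S_n)|\le N_n\,r^{r-2}(2D_n)^{r-1}A^r$. *)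

(* Defs.v *)
From HB Require Import structures.
From mathcomp Require Import all_boot all_order all_algebra.
From mathcomp Require Import all_classical all_reals all_analysis.
Set Implicit Arguments.
Unset Strict Implicit.
Unset Printing Implicit Defensive.
Import Order.TTheory GRing.Theory Num.Theory.
Import numFieldNormedType.Exports.

#[local] Open Scope classical_set_scope.
#[local] Open Scope ring_scope.

Definition kolmogorov_distance (d : measure_display) (T : measurableType d)
    (R : realType) (P : probability T R) (X : {RV P >-> R})
    (nu : probability (measurableTypeR R) R) : R :=
  sup (range (fun a : R =>
    `|fine (P [set x | X x <= a]) - fine (nu [set y : R | y <= a])|)).

(* E[e^{zX}] converges absolutely on a complex disc around 0 iff it does so on
   a real interval around 0, since |e^{zX}| = e^{(Re z) X}. *)
Definition mgf_cvg_near0 (d : measure_display) (T : measurableType d)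
    (R : realType) (P : probability T R) (X : {RV P >-> R}) : Prop :=
  \forall z \near (0 : R), ('M_P X z < +oo)%E.

(* k is the coefficient sequence in
     log E[e^{zX}] = \sum_(r >= 1) k r / r! * z ^ r.
   The coefficients are determined by this identity for real z near 0; the
   entry k 0 plays no role. *)
Definition is_cumulants (d : measure_display) (T : measurableType d)
    (R : realType) (P : probability T R) (X : {RV P >-> R})
    (k : nat -> R) : Prop :=
  \forall z \near (0 : R),
    (\sum_(1 <= r < n) k r / r`!%:R * z ^+ r) @[n --> \oo] -->
      ln (fine ('M_P X z)).

(* The r-th cumulant, for r >= 1; only meaningful under mgf_cvg_near0, which
   guarantees that the expansion exists. *)
Definition cumulant (d : measure_display) (T : measurableType d)
    (R : realType) (P : probability T R) (X : {RV P >-> R}) (r : nat) : R :=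
  xget (fun=> 0) [set k : nat -> R | is_cumulants X k] r.

Definition uniform_cumulant_bounds (R : realType) (d : nat -> measure_display)
    (T : forall n, measurableType (d n)) (P : forall n, probability (T n) R)
    (S : forall n, {RV (P n) >-> R}) (D N : nat -> R) (A : R) : Prop :=
  [/\ 0 < A,
      forall n, 0 < D n,
      forall n, 0 < N n &
      forall n r, (2 <= r)%N ->
        `|cumulant (S n) r| <=
          N n * r%:R ^+ (r - 2) * (2 * D n) ^+ (r - 1) * A ^+ r].

(* Main.v *)
Require Import Defs.
From HB Require Import structures.
From mathcomp Require Import all_boot all_order all_algebra.
From mathcomp Require Import all_classical all_reals all_analysis.
From mathcomp Require Import ring lra measurable_realfun gauss_integral.
Import Order.TTheory GRing.Theory Num.Theory.
Import numFieldNormedType.Exports.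
Set Implicit Arguments.
Unset Strict Implicit.
Unset Printing Implicit Defensive.
#[local] Open Scope classical_set_scope.
#[local] Open Scope ring_scope.

(* The bounds on the cumulants make the cumulant series converge on an explicit
   disc, which can exceed the interval where the moment generating function was
   assumed finite; the recursion between moments and cumulants then bounds the
   moments too, so that on this whole disc the characteristic function of Y_n
   is exp(- t^2/2 + h(t)) with h the cumulant series from order three on.

   With delta = A^3/sigma^3 sqrt(D/N), Stirling-type bounds give
   |h(t)| <= 2 delta t^3 / (1 - 12 delta t), hence |h(t)| <= t^2/4 for
   |t| <= 1/(20 delta).  Smoothing both distribution functions by the Fejer
   kernel (1 - cos w)/w^2 at scale 1/(20 delta) turns their difference into an
   integral of the difference of the characteristic functions, at most
   12 delta; Esseen's self-bounding argument removes the smoothing at the cost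
   of a multiple of the Lipschitz constant 1/sqrt(2 pi) of the normal
   distribution function.  In total the distance is at most 73.6 delta. *)

(** The cumulant bounds control the characteristic function on a bounded range of frequencies only.
    Hence the smoothing kernel must have a compactly supported Fourier transform, with a cut-off
    inside the disc of the cumulant series; it must also be nonnegative, so that one-sided
    comparisons of distribution functions survive the averaging.

    Passing from the given interval to the larger disc needs no analytic continuation. [exp_rel] is
    an identity between coefficients: it is matched with the cumulants near 0 on the real axis and
    can be summed at imaginary arguments wherever both series converge. Complex numbers are replaced
    by pairs: the expectations of cosine and sine, and the signs [reI], [imI] of the powers of i.

    The constant 20 is the smallest c for which the bound on h gives |h| <= t^2/4 up to t = 1/(c
    delta), with equality at the end point. Half of the Gaussian exponent pays for exp |h|, and
    exp(- t^2/4) is left. The total 73.6 is 8 * 0.41 * 20 + 8, where 0.41 bounds 1/sqrt(2 pi) and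
    the last 8 bounds 24/pi. *)

Section power_series.
Context {R : realType}.
Implicit Types (f g : nat -> R) (x y t : R).

(** * Sums, derivatives, products and uniqueness of real power series *)

Definition psum f t : R := limn (pseries f t).

(** A form of [the radius of convergence is at least x]. Only boundedness of the terms at [x] is
    asked, so every operation below keeps this form after an arbitrarily small loss of radius. *)
Definition coef_bounded f x := exists C, forall r, `|f r| * x ^+ r <= C.

Lemma coef_bounded_cst_ge0 f x : 0 <= x -> coef_bounded f x ->
  exists2 C, 0 <= C & forall r, `|f r| * x ^+ r <= C.
Proof.
move=> x0 [C HC]; exists C => //.
by apply: le_trans (HC 0%N); rewrite mulr_ge0// exprn_ge0.
Qed.

Lemma is_cvg_geometric_norm f C q : 0 <= q < 1 ->
  (forall r, `|f r| <= C * q ^+ r) -> cvgn [normed series f].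
Proof.
move=> /andP[q0 q1] fC; apply: (@series_le_cvg _ _ (geometric C q)) => //.
- by move=> n; exact: normr_ge0.
- by move=> n; exact: le_trans (normr_ge0 _) (fC n).
- by apply: is_cvg_geometric_series; rewrite ger0_norm.
Qed.

Lemma coef_bounded_geo f x t : coef_bounded f x -> `|t| < x ->
  exists C, forall r, `|f r * t ^+ r| <= C * (`|t| / x) ^+ r.
Proof.
move=> [C HC] tx; have x0 : 0 < x by apply: le_lt_trans tx.
exists C => r; rewrite normrM normrX expr_div_n.
have -> : `|f r| * `|t| ^+ r = (`|f r| * x ^+ r) * (`|t| ^+ r / x ^+ r).
  by rewrite mulrACA divff ?mulr1// gt_eqF// exprn_gt0.
by rewrite ler_wpM2r// divr_ge0 ?exprn_ge0// ltW.
Qed.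

Lemma is_cvg_psum_norm f x t : coef_bounded f x -> `|t| < x ->
  cvgn [normed pseries f t].
Proof.
move=> fx tx; have x0 : 0 < x by apply: le_lt_trans tx.
have [C HC] := coef_bounded_geo fx tx; apply: is_cvg_geometric_norm HC.
by rewrite divr_ge0 ?(ltW x0)//= ltr_pdivrMr// mul1r.
Qed.

Lemma is_cvg_psum f x t : coef_bounded f x -> `|t| < x ->
  cvgn (pseries f t).
Proof. by move=> fx tx; exact/normed_cvg/(is_cvg_psum_norm fx tx). Qed.

Lemma cvg_psum f x t : coef_bounded f x -> `|t| < x ->
  pseries f t @ \oo --> psum f t.
Proof. by move=> fx tx; exact: is_cvg_psum fx tx. Qed.

Lemma pseries0E f n : pseries f 0 n.+1 = f 0%N.
Proof.
rewrite /pseries /series /= big_nat_recl//= expr0 mulr1 big1 ?addr0// => i _.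
by rewrite expr0n mulr0.
Qed.

Lemma psum0E f : psum f 0 = f 0%N.
Proof.
apply: cvg_lim => //; rewrite -(cvg_shiftS (pseries f 0)).
rewrite (_ : (fun _ => _) = cst (f 0%N)); first exact: cvg_cst.
by apply/funext => n; rewrite /= pseries0E.
Qed.

Lemma coef_bounded_le f x y : 0 <= y <= x -> coef_bounded f x ->
  coef_bounded f y.
Proof.
move=> /andP[y0 yx] [C HC]; exists C => r; apply: le_trans (HC r).
by rewrite ler_wpM2l// lerXn2r ?nnegrE// (le_trans y0).
Qed.

Lemma coef_boundedW f g x : 0 <= x -> (forall r, `|g r| <= `|f r|) ->
  coef_bounded f x -> coef_bounded g x.
Proof.
move=> x0 gf [C HC]; exists C => r; apply: le_trans (HC r).
by rewrite ler_wpM2r ?exprn_ge0.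
Qed.

(** Each of the n + 1 copies of q^n is at most q^i for some i <= n, so a geometric sum bounds them.
    This absorbs the factor r + 1 that differentiation and Cauchy products create, at the price of a
    smaller radius. *)
Lemma natrX_bound (q : R) n : 0 <= q < 1 -> n.+1%:R * q ^+ n <= (1 - q)^-1.
Proof.
move=> /andP[q0 q1]; rewrite -[leRHS]mul1r ler_pdivlMr ?subr_gt0//.
have -> : n.+1%:R * q ^+ n = \sum_(i < n.+1) q ^+ n.
  by rewrite sumr_const card_ord mulr_natl.
apply: (@le_trans _ _ ((\sum_(i < n.+1) q ^+ i) * (1 - q))).
  rewrite ler_wpM2r ?subr_ge0 ?(ltW q1)//; apply: ler_sum => i _.
  by rewrite ler_wiXn2l ?(ltW q1)// -ltnS.
have := subrX1 q n.+1; move: (\sum_(i < _) _) (q ^+ n.+1) (exprn_ge0 n.+1 q0).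
by move=> s p p0 h; nra.
Qed.

Lemma coef_bounded_diffs f x y : 0 <= y < x -> coef_bounded f x ->
  coef_bounded (pseries_diffs f) y.
Proof.
move=> /andP[y0 yx] fx; have x0 : 0 < x by apply: le_lt_trans yx.
have [C C0 HC] := coef_bounded_cst_ge0 (ltW x0) fx.
have q01 : 0 <= y / x < 1.
  by rewrite divr_ge0 ?(ltW x0)//= ltr_pdivrMr// mul1r.
exists (C / x * (1 - y / x)^-1) => r; rewrite /pseries_diffs normrM normr_nat.
have -> : r.+1%:R * `|f r.+1| * y ^+ r =
    `|f r.+1| * x ^+ r.+1 / x * (r.+1%:R * (y / x) ^+ r).
  rewrite expr_div_n exprS; field.
  by rewrite (gt_eqF x0) gt_eqF ?exprn_gt0.
apply: ler_pM; rewrite ?natrX_bound// ?mulr_ge0 ?exprn_ge0 ?invr_ge0//.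
- exact: ltW.
- exact: ltW.
- by case/andP: q01; rewrite mulr_ge0// invr_ge0 ltW.
- by rewrite ler_wpM2r ?HC// invr_ge0 ltW.
Qed.

Lemma is_derive_psum f x t : coef_bounded f x -> `|t| < x ->
  is_derive t 1 (psum f) (psum (pseries_diffs f) t).
Proof.
move=> fx tx; have x0 : 0 < x by apply: le_lt_trans tx.
(* The radii satisfy |t| < K < y < z < x: each of the two differentiations loses some radius, and
   [pseries_snd_diffs] wants all three series convergent at the one point [K]. *)
pose K := (`|t| + x) / 2; pose y := (K + x) / 2; pose z := (y + x) / 2.
have t0 : 0 <= `|t| by [].
have tK : `|t| < K by rewrite /K; lra.
have Kx : `|K| < x by rewrite ger0_norm /K; lra.
have Ky : `|K| < y by rewrite ger0_norm /y /K; lra.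
have Kz : `|K| < z by rewrite ger0_norm /z /y /K; lra.
have fz : coef_bounded (pseries_diffs f) z.
  by apply: coef_bounded_diffs fx; rewrite /z /y /K; lra.
have fy : coef_bounded (pseries_diffs (pseries_diffs f)) y.
  by apply: coef_bounded_diffs fz; rewrite /z /y /K; lra.
apply: (@pseries_snd_diffs _ _ K).
- exact: is_cvg_psum fx Kx.
- exact: is_cvg_psum fz Kz.
- exact: is_cvg_psum fy Ky.
- by rewrite (lt_le_trans tK)// ler_norm.
Qed.

Definition conv f g : nat -> R := fun n => \sum_(i < n.+1) f i * g (n - i)%N.

Lemma cvg_natrX (q : R) : 0 <= q < 1 ->
  (fun n => n%:R * q ^+ n : R^o) @ \oo --> (0 : R^o).
Proof.
move=> q01; have : cvgn (series (fun n => n%:R * q ^+ n)).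
  have [q0 q1] := andP q01; pose x := (1 + q) / 2.
  have fx : coef_bounded (fun=> 1 : R) 1 by exists 1 => r; rewrite normr1 expr1n mulr1.
  have xx : coef_bounded (pseries_diffs (fun=> 1 : R)) x.
    by apply: coef_bounded_diffs fx; rewrite /x; lra.
  have xxx : coef_bounded (fun n => n%:R : R) x.
    by apply: coef_boundedW xx => [|r]; rewrite /pseries_diffs ?mulr1 ?normr_nat ?ler_nat// /x; lra.
  by apply: is_cvg_psum xxx _; rewrite ger0_norm// /x; lra.
exact: cvg_series_cvg_0.
Qed.

(** The partial sums are values at 1 of polynomials of size N. In their product the lower N
    coefficients form the partial sum of the Cauchy product, and the upper N ones are geometrically
    small. *)
Lemma psum_conv f g x t : coef_bounded f x -> coef_bounded g x -> `|t| < x ->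
  psum (conv f g) t = psum f t * psum g t.
Proof.
move=> fx gx tx; have x0 : 0 < x by apply: le_lt_trans tx.
have [C HC] := coef_bounded_geo fx tx.
have [D HD] := coef_bounded_geo gx tx.
set q := `|t| / x in HC HD; have q0 : 0 <= q by rewrite divr_ge0 ?(ltW x0).
have q1 : q < 1 by rewrite ltr_pdivrMr// mul1r.
have C0 : 0 <= C.
  by have := HC 0%N; rewrite [X in _ <= X]mulr1; exact: le_trans (normr_ge0 _).
have D0 : 0 <= D.
  by have := HD 0%N; rewrite [X in _ <= X]mulr1; exact: le_trans (normr_ge0 _).
pose A := pseries f t; pose B := pseries g t; pose E := pseries (conv f g) t.
(* Each of the N upper coefficients has at most 2N terms bounded by C D q^N. The square root of [q]
   writes N^2 q^N as a square, to which [cvg_natrX] applies. *)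
have key N : `|A N * B N - E N| <= 2 * C * D * (N%:R * (Num.sqrt q) ^+ N) ^+ 2.
  pose p := \poly_(i < N) (f i * t ^+ i); pose r := \poly_(i < N) (g i * t ^+ i).
  have sp : (size p <= N)%N by exact: size_poly.
  have sr : (size r <= N)%N by exact: size_poly.
  have AE : A N = p.[1].
    rewrite (horner_coef_wide _ sp) /A /pseries /series /= big_mkord.
    by apply: eq_bigr => i _; rewrite coef_poly ltn_ord expr1n mulr1.
  have BE : B N = r.[1].
    rewrite (horner_coef_wide _ sr) /B /pseries /series /= big_mkord.
    by apply: eq_bigr => i _; rewrite coef_poly ltn_ord expr1n mulr1.
  have spr : (size (p * r)%R <= N + N)%N.
    apply: leq_trans (size_polyMleq _ _) _.
    by apply: (leq_trans (leq_pred _)); exact: leq_add.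
  rewrite AE BE -hornerM (horner_coef_wide _ spr).
  under eq_bigr do rewrite expr1n mulr1.
  rewrite big_split_ord/=.
  have -> : \sum_(i < N) (p * r)`_i = E N.
    rewrite /E /pseries /series /= big_mkord; apply: eq_bigr => i _.
    rewrite coefM /conv mulr_suml; apply: eq_bigr => j _.
    have ji : (j <= i)%N by rewrite -ltnS.
    rewrite !coef_poly (leq_ltn_trans ji)// (leq_ltn_trans (leq_subr _ _))//.
    by rewrite mulrACA -exprD subnKC.
  rewrite addrAC subrr add0r; apply: le_trans (ler_norm_sum _ _ _) _.
  apply: (@le_trans _ _ (\sum_(i < N) (2 * N%:R * (C * D * q ^+ N)))); last first.
    have -> : (N%:R * Num.sqrt q ^+ N) ^+ 2 = N%:R ^+ 2 * q ^+ N.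
      by rewrite (exprMn 2%N) -exprM mulnC exprM sqr_sqrtr.
    rewrite sumr_const card_ord -[leLHS]mulr_natl.
    by rewrite le_eqVlt; apply/orP; left; apply/eqP; ring.
  apply: ler_sum => i _; rewrite coefM; apply: le_trans (ler_norm_sum _ _ _) _.
  apply: (@le_trans _ _ (\sum_(j < (N + i).+1) (C * D * q ^+ N))).
    apply: ler_sum => j _; rewrite !coef_poly normrM.
    apply: (@le_trans _ _ ((C * q ^+ j) * (D * q ^+ (N + i - j)))).
      apply: ler_pM => //; case: ifP => // _; rewrite normr0;
        by rewrite mulr_ge0 ?exprn_ge0.
    have jNi : (j <= N + i)%N by rewrite -ltnS.
    rewrite mulrACA -exprD subnKC// exprD ler_wpM2l ?mulr_ge0//.
    by rewrite ler_piMr ?exprn_ge0// exprn_ile1// ltW.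
  rewrite sumr_const card_ord -[leLHS]mulr_natl ler_wpM2r//.
    by rewrite !mulr_ge0 ?exprn_ge0.
  by rewrite -natrM ler_nat mul2n -addnn -addnS leq_add2l.
have s01 : 0 <= Num.sqrt q < 1.
  by rewrite sqrtr_ge0/= -(@sqrtr1 R) ltr_sqrt.
have cE0 : (fun N => A N * B N - E N) @ \oo --> (0 : R).
  apply/norm_cvg0P.
  apply: (@squeeze_cvgr _ _ _ _ (cst 0) (fun N => 2 * C * D * (N%:R * (Num.sqrt q) ^+ N) ^+ 2)).
  - by near=> n; rewrite normr_ge0 key.
  - exact: cvg_cst.
  - have c0 := cvg_natrX s01.
    have -> : 0 = 2 * C * D * (0 * 0) :> R by rewrite !mulr0.
    by apply: cvgM (cvg_cst _) _; exact: (cvgM c0 c0).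
have AB : A N * B N @[N --> \oo] --> psum f t * psum g t.
  by apply: cvgM; [exact: cvg_psum fx tx|exact: cvg_psum gx tx].
apply: cvg_lim => //; rewrite -[X in _ --> X]subr0.
have -> : pseries (conv f g) t = fun N => A N * B N - (A N * B N - E N).
  by apply/funext => N; rewrite subKr.
exact: cvgB.
Unshelve. all: by end_near. Qed.

Lemma psum_lin f g (c d : R) x t : coef_bounded f x -> coef_bounded g x ->
  `|t| < x ->
  psum (fun r => c * f r + d * g r) t = c * psum f t + d * psum g t.
Proof.
move=> fx gx tx; apply: cvg_lim => //.
have -> : pseries (fun r => c * f r + d * g r) t =
    (fun n => c * pseries f t n + d * pseries g t n).
  apply/funext => n; rewrite /pseries /series /= !mulr_sumr -big_split/=.
  by apply: eq_bigr => i _; rewrite mulrDl !mulrA.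
by apply: cvgD; apply: cvgM (cvg_cst _) _; [exact: cvg_psum fx tx|exact: cvg_psum gx tx].
Qed.

(** If [f n] were the first nonzero coefficient, f n * t^n would cancel a tail of order t^(n+1), so
    |f n| <= M t for all small t > 0. *)
Lemma psum_eq0 f x : 0 < x -> coef_bounded f x ->
  (\forall t \near (0 : R), psum f t = 0) -> forall r, f r = 0.
Proof.
move=> x0 fx f0 r; elim/ltn_ind: r => n IH.
have [C C0 HC] := coef_bounded_cst_ge0 (ltW x0) fx.
apply/eqP; rewrite -normr_le0 leNgt; apply/negP => fn0.
(* For t < x/2 the tail is dominated by a geometric series of ratio 1/2, whence the factor 2. *)
pose M := C * 2 / x ^+ n.+1.
have M0 : 0 <= M by rewrite divr_ge0 ?mulr_ge0 ?exprn_ge0 ?(ltW x0).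
have key t : 0 < t < x / 2 -> psum f t = 0 -> `|f n| <= M * t.
  move=> /andP[t0 tx] ft.
  have tx' : `|t| < x by rewrite ger0_norm ?ltW// (lt_trans tx)// ltr_pdivrMr//; lra.
  have := cvg_psum fx tx'; rewrite ft => cf.
  have cfn : (fun m => pseries f t (n.+1 + m)%N) @ \oo --> (0 : R).
    have -> : (fun m => pseries f t (n.+1 + m)%N) = (fun m => pseries f t (m + n.+1)%N).
      by apply/funext => m; rewrite addnC.
    by rewrite (cvg_shiftn n.+1 (pseries f t)).
  have b m : `|f n * t ^+ n| <= `|pseries f t (n.+1 + m)%N| + M * t ^+ n.+1.
    have -> : pseries f t (n.+1 + m)%N =
      f n * t ^+ n + \sum_(i < m) f (n.+1 + i)%N * t ^+ (n.+1 + i).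
      rewrite /pseries /series /= big_mkord big_split_ord/= big_ord_recr/=.
      rewrite big1 ?add0r// => i _; rewrite IH ?mul0r//.
    set s := \sum_(i < m) _.
    suff sM : `|s| <= M * t ^+ n.+1.
      rewrite -lerBlDr; apply: (@le_trans _ _ (`|f n * t ^+ n| - `|s|)).
        by rewrite lerD2l lerN2.
      by rewrite -[in leRHS](opprK s); apply: le_trans (lerB_dist _ _); rewrite normrN.
    apply: le_trans (ler_norm_sum _ _ _) _.
    apply: (@le_trans _ _ (\sum_(i < m) C / x ^+ n.+1 * t ^+ n.+1 * 2^-1 ^+ i)).
      apply: ler_sum => i _; rewrite normrM normrX (ger0_norm (ltW t0)) exprD.
      rewrite -exprD.
      have -> : `|f (n.+1 + i)%N| * t ^+ (n.+1 + i) =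
          `|f (n.+1 + i)%N| * x ^+ (n.+1 + i) * ((t / x) ^+ n.+1 * (t / x) ^+ i).
        by rewrite -exprD expr_div_n; field; rewrite expf_neq0// gt_eqF.
      have -> : C / x ^+ n.+1 * t ^+ n.+1 * 2^-1 ^+ i =
          C * ((t / x) ^+ n.+1 * 2^-1 ^+ i) by rewrite expr_div_n; ring.
      have tx0 : 0 <= t / x by rewrite divr_ge0 ?(ltW t0) ?(ltW x0).
      apply: ler_pM => //; rewrite ?mulr_ge0 ?exprn_ge0 ?(ltW x0)//.
      rewrite ler_wpM2l ?exprn_ge0// lerXn2r ?nnegrE ?invr_ge0//.
      by rewrite ler_pdivrMr// mulrC ltW.
    rewrite -mulr_sumr.
    have -> : M * t ^+ n.+1 = C / x ^+ n.+1 * t ^+ n.+1 * 2 by rewrite /M; ring.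
    rewrite ler_wpM2l ?mulr_ge0 ?invr_ge0 ?exprn_ge0 ?(ltW t0) ?(ltW x0)//.
    have := @subrX1 R 2^-1 m; set S := \sum_(i < m) _.
    have : 0 <= (2^-1 : R) ^+ m by rewrite exprn_ge0.
    by lra.
  have : `|f n * t ^+ n| <= `|0 : R| + M * t ^+ n.+1.
    have cg : (fun m => `|pseries f t (n.+1 + m)%N| + M * t ^+ n.+1) @ \oo -->
        `|0 : R| + M * t ^+ n.+1.
      by apply: cvgD; [exact: cvg_norm|exact: cvg_cst].
    by apply: ler_cvg_to (cvg_cst _) cg _; near=> m; exact: b.
  rewrite normr0 add0r normrM normrX (ger0_norm (ltW t0)) exprS mulrA.
  by rewrite ler_pM2r// exprn_gt0.
have /nbhs_ballP[e /= e0 He] := f0.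
pose t := Num.min (Num.min e (x / 2)) (`|f n| / (M + 1)) / 2.
have t2 : 0 < Num.min (Num.min e (x / 2)) (`|f n| / (M + 1)).
  by rewrite !lt_min e0 !divr_gt0//= ltr_wpDl.
have te : t < e /\ t < x / 2 /\ t < `|f n| / (M + 1).
  have : t < Num.min (Num.min e (x / 2)) (`|f n| / (M + 1)).
    by rewrite /t ltr_pdivrMr//; lra.
  by rewrite !lt_min => /andP[/andP[-> ->] ->].
have t0 : 0 < t by rewrite divr_gt0.
have [te1 [te2 te3]] := te.
have : `|f n| <= M * t.
  apply: key; first by rewrite t0.
  by apply: He; rewrite /ball/= sub0r normrN ger0_norm// ltW.
move: te3; rewrite ltr_pdivlMr ?ltr_wpDl// => te3.
by nra.
Unshelve. all: by end_near. Qed.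

(** * Exponentials and logarithms of power series *)

Lemma is_derive1M (f g : R -> R) (s df dg : R) :
  is_derive s 1 f df -> is_derive s 1 g dg ->
  is_derive s 1 (fun r => f r * g r) (df * g s + f s * dg).
Proof.
move=> hf hg; have h := is_deriveM hf hg; apply: is_derive_eq h _.
by rewrite /GRing.scale /= addrC (mulrC (g s)).
Qed.

Lemma derive0_cst_ball (f : R -> R) x t :
  (forall s : R, `|s| < x -> is_derive s 1 f (0 : R)) -> `|t| < x -> f t = f 0.
Proof.
move=> f' tx; have cf (a b : R) : - x < a -> b < x ->
    {within `[a, b], continuous f}.
  move=> xa bx; apply: derivable_within_continuous => s; rewrite in_itv/= => /andP[sa sb].
  have : `|s| < x by rewrite ltr_norml (lt_le_trans xa sa) (le_lt_trans sb bx).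
  by move/f' => [].
have f'ab (a b : R) : - x < a -> b < x ->
    forall s, s \in `]a, b[ -> is_derive s 1 f (cst 0 s).
  move=> xa bx s; rewrite in_itv/= => /andP[sa sb]; apply: f'.
  by rewrite ltr_norml (lt_trans xa sa) (lt_trans sb bx).
have x0 : 0 < x by apply: le_lt_trans tx.
move: tx; rewrite ltr_norml => /andP[xt tx].
have [t0|t0] := leP 0 t.
  have x0' : - x < 0 by rewrite oppr_lt0.
  have [c _] := MVT_segment t0 (f'ab _ _ x0' tx) (cf _ _ x0' tx).
  by rewrite mul0r => /eqP; rewrite subr_eq0 => /eqP.
have [c _] := MVT_segment (ltW t0) (f'ab _ _ xt x0) (cf _ _ xt x0).
by rewrite mul0r => /eqP; rewrite subr_eq0 => /eqP.
Qed.

Lemma coef_bounded_conv f g x y : 0 <= y < x -> coef_bounded f x ->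
  coef_bounded g x -> coef_bounded (conv f g) y.
Proof.
move=> /andP[y0 yx] fx gx; have x0 : 0 < x by apply: le_lt_trans yx.
have [C C0 HC] := coef_bounded_cst_ge0 (ltW x0) fx.
have [D D0 HD] := coef_bounded_cst_ge0 (ltW x0) gx.
have q01 : 0 <= y / x < 1.
  by rewrite divr_ge0 ?(ltW x0)//= ltr_pdivrMr// mul1r.
exists (C * D * (1 - y / x)^-1) => r.
apply: (@le_trans _ _ (C * D * (r.+1%:R * (y / x) ^+ r))); last first.
  by rewrite ler_wpM2l ?mulr_ge0// natrX_bound.
apply: (@le_trans _ _ (\sum_(i < r.+1) C * D * (y / x) ^+ r)); last first.
  by rewrite sumr_const card_ord -[leLHS]mulr_natl mulrCA.
rewrite /conv; apply: (@le_trans _ _ ((\sum_(i < r.+1) `|f i * g (r - i)%N|) * y ^+ r)).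
  by rewrite ler_wpM2r ?exprn_ge0// ler_norm_sum.
rewrite mulr_suml; apply: ler_sum => i _.
have ir : (i <= r)%N by rewrite -ltnS.
have -> : `|f i * g (r - i)%N| * y ^+ r =
    (`|f i| * x ^+ i) * (`|g (r - i)%N| * x ^+ (r - i)) * (y / x) ^+ r.
  rewrite mulrACA -exprD subnKC// normrM expr_div_n; field.
  by rewrite expf_neq0// gt_eqF.
have [q0 _] := andP q01.
by rewrite ler_wpM2r ?exprn_ge0// ler_pM// mulr_ge0 ?exprn_ge0 ?(ltW x0).
Qed.

(** The radius [y] depends on [t] and [x] only, so two such products can be combined by
    [psum_lin]. *)
Lemma psum_conv_diffs f g x t : coef_bounded f x -> coef_bounded g x ->
  `|t| < x -> let y := (`|t| + x) / 2 in
  [/\ `|t| < y, coef_bounded (conv (pseries_diffs f) g) y &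
     psum (conv (pseries_diffs f) g) t = psum (pseries_diffs f) t * psum g t].
Proof.
move=> fx gx tx y; have t0 : 0 <= `|t| by [].
have fz : coef_bounded (pseries_diffs f) ((`|t| + 2 * x) / 3).
  by apply: coef_bounded_diffs fx; lra.
have gz : coef_bounded g ((`|t| + 2 * x) / 3).
  by apply: coef_bounded_le gx; lra.
split; rewrite /y; first lra.
- by apply: coef_bounded_conv fz gz; lra.
- by apply: psum_conv fz gz _; lra.
Qed.

(* a = exp b as formal power series, through a' = b' a; no convergence is
   required. *)
Definition exp_rel b a := [/\ b 0%N = 0, a 0%N = 1 &
  forall r, pseries_diffs a r = conv (pseries_diffs b) a r].

(* At (p, q) = (Re i^r, Im i^r) this is exp(b(it)) = a(it). Both sides solve the
   same linear differential system with the same initial value. *)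
Lemma psum_exp_rel b a (p q : nat -> R) x t : exp_rel b a ->
  coef_bounded b x -> coef_bounded a x -> `|t| < x ->
  p 0%N = 1 -> q 0%N = 0 ->
  (forall i, `|p i| <= 1) -> (forall i, `|q i| <= 1) ->
  (forall i j, p (i + j)%N = p i * p j - q i * q j) ->
  (forall i j, q (i + j)%N = p i * q j + q i * p j) ->
  let u := psum (fun r => b r * p r) t in let w := psum (fun r => b r * q r) t in
  psum (fun r => a r * p r) t = expR u * cos w /\
  psum (fun r => a r * q r) t = expR u * sin w.
Proof.
move=> [b0 a0 ba] bx ax tx p0 q0 p1 q1 pD qD u w.
have x0 : 0 < x by apply: le_lt_trans tx.
have bdd f p' : (forall i, `|p' i| <= 1) -> coef_bounded f x ->
    coef_bounded (fun r => f r * p' r) x.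
  move=> p'1; apply: coef_boundedW (ltW x0) _ => r.
  by rewrite normrM ler_piMr.
have [bp bq ap aq] := And4 (bdd _ _ p1 bx) (bdd _ _ q1 bx) (bdd _ _ p1 ax) (bdd _ _ q1 ax).
set U := psum (fun r => b r * p r); set W := psum (fun r => b r * q r).
set C := psum (fun r => a r * p r); set S := psum (fun r => a r * q r).
pose U' := psum (pseries_diffs (fun r => b r * p r)).
pose W' := psum (pseries_diffs (fun r => b r * q r)).
have dU (s : R) : `|s| < x -> is_derive s 1 U (U' s) by exact: is_derive_psum.
have dW (s : R) : `|s| < x -> is_derive s 1 W (W' s) by exact: is_derive_psum.
have dS (s : R) : `|s| < x -> is_derive s 1 S (U' s * S s + W' s * C s).
  move=> sx; have h := is_derive_psum aq sx; apply: is_derive_eq h _.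
  have [sy cy <-] := psum_conv_diffs bp aq sx.
  have [_ cz <-] := psum_conv_diffs bq ap sx.
  rewrite -[X in _ = X + _]mul1r -[X in _ = _ + X]mul1r -(psum_lin _ _ cy cz sy).
  congr psum; apply/funext => r; rewrite !mul1r {1}/pseries_diffs.
  rewrite mulrA; have := ba r; rewrite {1}/pseries_diffs => ->.
  rewrite /conv -big_split/= mulr_suml; apply: eq_bigr => i _.
  have -> : q r.+1 = q (i.+1 + (r - i))%N by rewrite addSn subnKC// -ltnS.
  by rewrite /pseries_diffs qD; ring.
have dC (s : R) : `|s| < x -> is_derive s 1 C (U' s * C s - W' s * S s).
  move=> sx; have h := is_derive_psum ap sx; apply: is_derive_eq h _.
  have [sy cy <-] := psum_conv_diffs bp ap sx.
  have [_ cz <-] := psum_conv_diffs bq aq sx.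
  rewrite -[X in _ = X + _]mul1r -[X in _ = _ - X]mul1r -mulNr -(psum_lin _ _ cy cz sy).
  congr psum; apply/funext => r; rewrite mul1r mulN1r {1}/pseries_diffs.
  rewrite mulrA; have := ba r; rewrite {1}/pseries_diffs => ->.
  rewrite /conv -sumrB/= mulr_suml; apply: eq_bigr => i _.
  have -> : p r.+1 = p (i.+1 + (r - i))%N by rewrite addSn subnKC// -ltnS.
  by rewrite /pseries_diffs pD; ring.
have dE (s : R) : `|s| < x -> is_derive s 1 (fun s => expR (- U s)) (expR (- U s) * - U' s).
  by move=> sx; apply: is_derive1_comp; exact: is_deriveN (dU _ sx).
have dcos (s : R) : `|s| < x -> is_derive s 1 (fun s => cos (W s)) (- sin (W s) * W' s).
  by move=> sx; apply: is_derive1_comp; exact: dW.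
have dsin (s : R) : `|s| < x -> is_derive s 1 (fun s => sin (W s)) (cos (W s) * W' s).
  by move=> sx; apply: is_derive1_comp; exact: dW.
(* The functions in [dA] and [dB] are the real and imaginary parts of (C + iS) exp(- U - iW), whose
   derivative vanishes; at 0 they equal 1 and 0. *)
have dA (s : R) : `|s| < x -> is_derive s 1
    (fun s => expR (- U s) * (C s * cos (W s) + S s * sin (W s))) (0 : R).
  move=> sx.
  have h := is_derive1M (dE _ sx) (is_deriveD (is_derive1M (dC _ sx) (dcos _ sx))
     (is_derive1M (dS _ sx) (dsin _ sx))).
  by apply: is_derive_eq h _; rewrite !fctE/=; ring.
have dB (s : R) : `|s| < x -> is_derive s 1
    (fun s => expR (- U s) * (S s * cos (W s) + - (C s * sin (W s)))) (0 : R).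
  move=> sx.
  have h := is_derive1M (dE _ sx) (is_deriveD (is_derive1M (dS _ sx) (dcos _ sx))
     (is_deriveN (is_derive1M (dC _ sx) (dsin _ sx)))).
  by apply: is_derive_eq h _; rewrite !fctE/=; ring.
have := derive0_cst_ball dA tx; have := derive0_cst_ball dB tx.
have U0 : U 0 = 0 by rewrite /U psum0E b0 mul0r.
have W0 : W 0 = 0 by rewrite /W psum0E b0 mul0r.
have C0 : C 0 = 1 by rewrite /C psum0E a0 p0 mulr1.
have S0 : S 0 = 0 by rewrite /S psum0E a0 q0 mulr0.
rewrite U0 W0 C0 S0 oppr0 expR0 cos0 sin0 !(mulr0, mul0r, mul1r, mulr1, oppr0, addr0).
rewrite -[W t]/w -[U t]/u => hB hA.
have cs := cos2Dsin2 w; have ee := expRxMexpNx_1 u.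
have -> : C t = (expR u * expR (- u)) * ((cos w ^+ 2 + sin w ^+ 2) * C t).
  by rewrite cs ee !mul1r.
have -> : S t = (expR u * expR (- u)) * ((cos w ^+ 2 + sin w ^+ 2) * S t).
  by rewrite cs ee !mul1r.
split.
  transitivity (expR u * (cos w * (expR (- u) * (C t * cos w + S t * sin w)) -
    sin w * (expR (- u) * (S t * cos w - C t * sin w)))); first by ring.
  by rewrite hA hB mulr0 subr0 mulr1.
transitivity (expR u * (sin w * (expR (- u) * (C t * cos w + S t * sin w)) +
  cos w * (expR (- u) * (S t * cos w - C t * sin w)))); first by ring.
by rewrite hA hB mulr0 addr0 mulr1.
Qed.

Lemma near0_norm_lt x : 0 < x -> \forall t \near (0 : R), `|t| < x.
Proof.
by move=> x0; apply/nbhs_ballP; exists x => //= t; rewrite /ball/= sub0r normrN.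
Qed.

Lemma psum_inj f g x : 0 < x -> coef_bounded f x -> coef_bounded g x ->
  (\forall t \near (0 : R), psum f t = psum g t) -> f =1 g.
Proof.
move=> x0 fx gx fg r.
have [C HC] := fx; have [D HD] := gx.
have hx : coef_bounded (fun r => 1 * f r + (-1) * g r) x.
  exists (C + D) => k; rewrite mul1r mulN1r.
  apply: le_trans (lerD (HC k) (HD k)); rewrite -mulrDl ler_wpM2r ?exprn_ge0 ?(ltW x0)//.
  exact: ler_normB.
have := psum_eq0 x0 hx; move=> /(_ _ r); rewrite mul1r mulN1r => h.
apply/eqP; rewrite -subr_eq0; apply/eqP/h; near=> t.
have tx : `|t| < x by near: t; exact: near0_norm_lt.
rewrite (psum_lin _ _ fx gx tx) mul1r mulN1r.
have -> : psum f t = psum g t by near: t.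
by rewrite subrr.
Unshelve. all: by end_near. Qed.

Lemma coef_bounded_sum f x y : coef_bounded f x -> 0 <= y < x ->
  exists2 S, 0 <= S & forall n, \sum_(i < n) `|f i| * y ^+ i <= S.
Proof.
move=> fx /andP[y0 yx]; have x0 : 0 < x by apply: le_lt_trans yx.
have [C C0 HC] := coef_bounded_cst_ge0 (ltW x0) fx.
have q0 : 0 <= y / x by rewrite divr_ge0 ?(ltW x0).
have q1 : y / x < 1 by rewrite ltr_pdivrMr// mul1r.
exists (C / (1 - y / x)) => [|n]; first by rewrite divr_ge0// subr_ge0 ltW.
apply: (@le_trans _ _ (\sum_(i < n) C * (y / x) ^+ i)).
  apply: ler_sum => i _; have -> : `|f i| * y ^+ i = `|f i| * x ^+ i * (y / x) ^+ i.
    by rewrite expr_div_n; field; rewrite expf_neq0// gt_eqF.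
  by rewrite ler_wpM2r ?exprn_ge0.
rewrite -mulr_sumr ler_wpM2l// -[leRHS]mul1r ler_pdivlMr ?subr_gt0//.
have := subrX1 (y / x) n; move: (\sum_(i < n) _) (exprn_ge0 n q0) => s.
by move: (_ ^+ n) => z z0 h; nra.
Qed.

(* The recursion r a_r = \sum_i i b_i a_(r - i) propagates a geometric bound on the
   first m coefficients as soon as m is at least the sum of |i b_i| y^i. *)
Lemma exp_rel_coef_bounded b a x y : exp_rel b a -> coef_bounded b x ->
  0 <= y < x -> coef_bounded a y.
Proof.
move=> [b0 a0 ba] bx /andP[y0 yx].
have bz : coef_bounded (pseries_diffs b) ((x + y) / 2).
  by apply: coef_bounded_diffs bx; lra.
have [S S0 HS] : exists2 S, 0 <= S &
    forall n, \sum_(i < n) `|pseries_diffs b i| * y ^+ i <= S.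
  by apply: coef_bounded_sum bz _; lra.
pose m := (Num.truncn (S * y)).+1.
have mS : S * y <= m%:R by rewrite ltW// truncnS_gt.
pose C := \sum_(i < m.+1) `|a i| * y ^+ i.
exists C => r; elim/ltn_ind: r => r IH.
have [rm|mr] := ltnP r m.+1.
  rewrite /C (bigD1 (Ordinal rm))//= lerDl sumr_ge0// => i _.
  by rewrite mulr_ge0 ?exprn_ge0.
have C0 : 0 <= C by apply: sumr_ge0 => i _; rewrite mulr_ge0 ?exprn_ge0.
case: r => // r in IH mr *.
have r0 : 0 < r.+1%:R :> R by rewrite ltr0n.
rewrite -(ler_pM2l r0); apply: (@le_trans _ _ (S * y * C)); last first.
  by rewrite ler_wpM2r// (le_trans mS)// ler_nat ltnW.
have -> : r.+1%:R * (`|a r.+1| * y ^+ r.+1) = `|conv (pseries_diffs b) a r| * y ^+ r.+1.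
  by rewrite -ba /pseries_diffs normrM normr_nat mulrA.
apply: (@le_trans _ _ (\sum_(i < r.+1) `|pseries_diffs b i| * y ^+ i * y * C)); last first.
  by rewrite -!mulr_suml ler_wpM2r// ler_wpM2r.
apply: (@le_trans _ _ ((\sum_(i < r.+1) `|pseries_diffs b i * a (r - i)%N|) * y ^+ r.+1)).
  by rewrite ler_wpM2r ?exprn_ge0// ler_norm_sum.
rewrite mulr_suml; apply: ler_sum => i _; have ir : (i <= r)%N by rewrite -ltnS.
have -> : `|pseries_diffs b i * a (r - i)%N| * y ^+ r.+1 =
    `|pseries_diffs b i| * y ^+ i * y * (`|a (r - i)%N| * y ^+ (r - i)).
  have -> : y ^+ r.+1 = y * (y ^+ i * y ^+ (r - i)) by rewrite -exprD subnKC// exprS.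
  by rewrite normrM; ring.
rewrite ler_wpM2l ?mulr_ge0 ?exprn_ge0// IH// ltnS leq_subr//.
Qed.

(** Coefficients of the derivative of the formal logarithm of [a], obtained by solving a' = b' a
    degree by degree. Each entry depends on all earlier ones, so the recursion carries the whole
    list. *)
Fixpoint log_coefs a n : seq R := if n is m.+1 then
  let s := log_coefs a m in
  rcons s (pseries_diffs a m - \sum_(i < m) s`_i * a (m - i)%N) else [::].

Lemma size_log_coefs a n : size (log_coefs a n) = n.
Proof. by elim: n => // n IH; rewrite /= size_rcons IH. Qed.

Lemma nth_log_coefs a m n : (m < n)%N ->
  (log_coefs a n)`_m = (log_coefs a m.+1)`_m.
Proof.
elim: n => // n IH; rewrite ltnS leq_eqVlt => /predU1P[->//|mn].
by rewrite [LHS]/= nth_rcons size_log_coefs mn IH.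
Qed.

Lemma log_coefsE a n : (log_coefs a n.+1)`_n =
  pseries_diffs a n - \sum_(i < n) (log_coefs a i.+1)`_i * a (n - i)%N.
Proof.
rewrite [LHS]/= nth_rcons size_log_coefs ltnn eqxx; congr (_ - _).
by apply: eq_bigr => i _; rewrite nth_log_coefs.
Qed.

(** The formal logarithm exists because a 0 = 1 makes the recursion solvable. Its radius is merely
    shown to be positive, by an induction in which the convolution term costs at most half of the
    bound. *)
Lemma exp_rel_exists a x : 0 < x -> a 0%N = 1 -> coef_bounded a x ->
  exists b, exp_rel b a /\ exists2 y, 0 < y & coef_bounded b y.
Proof.
move=> x0 a0 ax.
pose be n := (log_coefs a n.+1)`_n.
have beE n : be n = pseries_diffs a n - \sum_(i < n) be i * a (n - i)%N.
  exact: log_coefsE.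
pose b n := if n is m.+1 then be m / m.+1%:R else 0.
have bbe : pseries_diffs b = be.
  by apply/funext => n; rewrite /pseries_diffs /b mulrC divfK// pnatr_eq0.
exists b; split.
  split => // r; rewrite bbe /conv big_ord_recr/= subnn a0 mulr1 beE.
  by rewrite addrC subrK.
have [C C0 HC] := coef_bounded_cst_ge0 (ltW x0) ax.
(* At radius q x the coefficients of [a] of index at least 1 sum to at most C q / (1 - q) = C / (2 C
   + 1) <= 1/2, so the bound 2 D reproduces itself as D + 2 D / 2. *)
pose q := (2 * C + 2)^-1; have q0 : 0 < q by rewrite invr_gt0; lra.
have qC : q * (2 * C + 2) = 1 by rewrite mulVf// gt_eqF//; lra.
have q1 : q <= 1 / 2 by rewrite /q -invf_div invr1 mulr1 lef_pV2 ?posrE; lra.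
pose y := q * x; have y0 : 0 < y by rewrite mulr_gt0.
have yx : y < x by rewrite /y; nra.
have ay : coef_bounded (pseries_diffs a) y.
  by apply: coef_bounded_diffs ax; rewrite ltW.
have [D D0 HD] := coef_bounded_cst_ge0 (ltW y0) ay.
have bey n : `|be n| * y ^+ n <= 2 * D.
  elim/ltn_ind: n => n IH; rewrite beE.
  apply: (@le_trans _ _ (D + \sum_(i < n) 2 * D * (`|a (n - i)%N| * y ^+ (n - i)))).
    apply: (@le_trans _ _ ((`|pseries_diffs a n| + \sum_(i < n) `|be i * a (n - i)%N|) * y ^+ n)).
      rewrite ler_wpM2r ?exprn_ge0 ?(ltW y0)//; apply: le_trans (ler_normB _ _) _.
      by rewrite lerD2l ler_norm_sum.
    rewrite mulrDl lerD// mulr_suml; apply: ler_sum => i _.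
    have -> : `|be i * a (n - i)%N| * y ^+ n =
        `|be i| * y ^+ i * (`|a (n - i)%N| * y ^+ (n - i)).
      by rewrite mulrACA -exprD subnKC ?normrM// ltnW.
    by rewrite ler_wpM2r ?IH// mulr_ge0 ?exprn_ge0 ?(ltW y0).
  rewrite -mulr_sumr; suff : \sum_(i < n) (`|a (n - i)%N| * y ^+ (n - i)) <= 1 / 2.
    by move: (\sum_(i < n) _) => s h; nra.
  apply: (@le_trans _ _ (\sum_(i < n) C * q * q ^+ (n - i.+1))).
    apply: ler_sum => i _; rewrite -mulrA -exprS subnSK//.
    by rewrite exprMn mulrCA [leRHS]mulrC ler_wpM2l ?exprn_ge0 ?(ltW q0).
  rewrite -mulr_sumr (reindex_inj rev_ord_inj)/=.
  have -> : \sum_(i < n) q ^+ (n - (n - i.+1).+1) = \sum_(i < n) q ^+ i.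
    by apply: eq_bigr => i _; rewrite subnSK// subKn// ltnW.
  have := subrX1 q n; move: (\sum_(i < n) _) (exprn_ge0 n (ltW q0)) => s.
  move: (q ^+ n) => z z0 h.
  have : C * q * s * (1 - q) <= C * q.
    have : 0 <= C * q by rewrite mulr_ge0 ?(ltW q0).
    by nra.
  have : C * q = 1 / 2 - q by lra.
  move=> ->; nra.
exists y => //; exists (2 * D * y) => -[|n]; rewrite /b.
  by rewrite normr0 mul0r !mulr_ge0// ltW.
rewrite exprS normrM normfV normr_nat.
apply: (@le_trans _ _ (`|be n| * y ^+ n * y)); last by rewrite ler_wpM2r ?(ltW y0).
rewrite mulrA [leLHS]mulrAC -!mulrA ler_wpM2l//.
rewrite ler_piMl ?(mulr_ge0 (exprn_ge0 n (ltW y0)) (ltW y0))//.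
by rewrite invf_le1 ?ler1n ?ltr0n.
Qed.

End power_series.

(** * Bounds by the exponential series, finite sums of integrals, powers of i *)

Lemma sum_exp_coeff_le (R : realType) (y : R) n :
  \sum_(r < n) `|y| ^+ r / r`!%:R <= expR `|y|.
Proof.
have -> : \sum_(r < n) `|y| ^+ r / r`!%:R = series (exp_coeff `|y|) n.
  by rewrite /series /= big_mkord; apply: eq_bigr.
apply: nondecreasing_cvgn_le; last exact: is_cvg_series_exp_coeff.
apply/nondecreasing_seqP => k; rewrite /series /= big_nat_recr//= lerDl.
by rewrite divr_ge0 ?exprn_ge0.
Qed.

Lemma exp_term_le (R : realType) (y : R) n : `|y| ^+ n / n`!%:R <= expR `|y|.
Proof.
apply: le_trans (sum_exp_coeff_le y n.+1); rewrite big_ord_recr/= lerDr.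
by rewrite sumr_ge0// => i _; rewrite divr_ge0// exprn_ge0.
Qed.

Lemma Rintegral_sum_nat d (T : measurableType d) (R : realType)
    (mu : {measure set T -> \bar R}) (f : nat -> T -> R) n :
  (forall i, mu.-integrable setT (EFin \o f i)) ->
  \int[mu]_w (\sum_(0 <= i < n) f i w) = \sum_(0 <= i < n) \int[mu]_w f i w.
Proof.
move=> fi; rewrite /Rintegral.
under eq_integral do rewrite -sumEFin.
rewrite integral_sum// sum_fine// => i _.
exact: (integrable_fin_num measurableT (fi i)).
Qed.

Section signs.
Context {R : realType}.

(* i^r = reI r + i imI r *)
Definition reI r : R := (~~ odd r)%:R * (-1) ^+ r./2.

(** [reI] and [imI] have the closed form of the cosine and sine coefficients without the factorial,
    so the two series are recognised through [cos_coeffE] and [sin_coeffE]. *)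
Definition imI r : R := (odd r)%:R * (-1) ^+ r.-1./2.

Lemma reIS r : reI r.+1 = - imI r.
Proof.
rewrite /reI /imI /= negbK; case: (boolP (odd r)) => [|_]; last by rewrite !mul0r oppr0.
by case: r => //= r _; rewrite !mul1r exprS mulN1r.
Qed.

Lemma imIS r : imI r.+1 = reI r.
Proof. by []. Qed.

Lemma reIimID i j : reI (i + j)%N = reI i * reI j - imI i * imI j /\
  imI (i + j)%N = reI i * imI j + imI i * reI j.
Proof.
elim: i => [|i [IHr IHi]]; first by rewrite add0n /reI /imI /= !mul1r !mul0r subr0 addr0.
by rewrite addSn !reIS !imIS IHr IHi; split; ring.
Qed.

Lemma reI_le1 i : `|reI i| <= 1.
Proof. by rewrite /reI normrM normr_sign mulr1 ger0_norm// lern1 leq_b1. Qed.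

Lemma imI_le1 i : `|imI i| <= 1.
Proof. by rewrite /imI normrM normr_sign mulr1 ger0_norm// lern1 leq_b1. Qed.

End signs.

(** Slot 0 is set to 0 because log E[e^(zX)] has no constant term, as [exp_rel] demands of its first
    argument. *)
Definition egf (R : realType) (k : nat -> R) r : R :=
  if r is 0 then 0 else k r / r`!%:R.

(** * Moments, cumulants and the characteristic function *)

Section moments.
Context d (T : measurableType d) (R : realType) (P : probability T R).
Variable X : {RV P >-> R}.

(** With the absolute value a single condition dominates exp(zX) for |z| <= x, all moments, and all
    partial sums of the series in X. *)
Definition exp_integrable (x : R) :=
  P.-integrable setT (EFin \o (fun w => expR (x * `|X w|))).

Definition mcoef r : R := (\int[P]_w (X w ^+ r)) / r`!%:R.

Lemma measurable_expRX (x : R) : measurable_fun setT (fun w => expR (x * `|X w|)).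
Proof.
apply: measurableT_comp => //; apply: measurable_funM => //.
by apply: measurableT_comp => //.
Qed.

Lemma measurable_Xn r : measurable_fun setT (fun w => X w ^+ r).
Proof. exact: measurable_funX. Qed.

Lemma exp_integrable_pow (x : R) r : 0 < x -> exp_integrable x ->
  P.-integrable setT (EFin \o (fun w => X w ^+ r)).
Proof.
move=> x0 hx; apply: (@le_integrable _ _ _ _ _ _ _
  (EFin \o (fun w => (r`!%:R / x ^+ r) * expR (x * `|X w|)))) => //.
- exact/measurable_EFinP/measurable_Xn.
- move=> w _ /=; have K0 : 0 <= r`!%:R / x ^+ r by rewrite divr_ge0// exprn_ge0// ltW.
  rewrite lee_fin [leRHS]ger0_norm ?(mulr_ge0 K0) ?expR_ge0// normrX.
  have := exp_term_le (x * `|X w|) r.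
  have -> : `|x * `|X w| | = x * `|X w| by rewrite normrM normr_id gtr0_norm.
  rewrite ler_pdivrMr ?ltr0n ?fact_gt0// exprMn -ler_pdivlMl ?exprn_gt0//.
  by move=> h; apply: le_trans h _; rewrite le_eqVlt; apply/orP; left; apply/eqP; ring.
- exact: (integrableZl _ _ hx).
Qed.

(** Dominated convergence: since |c r| <= 1, every partial sum is at most exp(x |X|). The choices 1,
    [reI] and [imI] for [c] give the exponential, the cosine and the sine. *)
Lemma cvg_mcoef (x t : R) (c : nat -> R) (phi : T -> R) :
  0 < x -> exp_integrable x -> `|t| <= x -> (forall r, `|c r| <= 1) ->
  (forall w, pseries (fun r => c r / r`!%:R) (t * X w) @ \oo --> phi w) ->
  pseries (fun r => mcoef r * c r) t @ \oo --> \int[P]_w (phi w).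
Proof.
move=> x0 hx tx c1 cphi.
pose f n w := pseries (fun r => c r / r`!%:R) (t * X w) n.
have mf n : measurable_fun setT (f n).
  rewrite /f /pseries /series /=.
  have -> : (fun w => \sum_(0 <= i < n) c i / i`!%:R * (t * X w) ^+ i) =
    (fun w => \sum_(0 <= i < n) (fun i w => c i / i`!%:R * (t * X w) ^+ i) i w) by [].
  apply: measurable_sum => i; apply: measurable_funM => //.
  by apply: measurable_funX; apply: measurable_funM.
have fle n w : `|f n w| <= expR (x * `|X w|).
  apply: (@le_trans _ _ (expR (`|t * X w|))); last first.
    by rewrite ler_expR normrM ler_wpM2r.
  apply: le_trans (sum_exp_coeff_le _ n).
  rewrite /f /pseries /series /= big_mkord; apply: le_trans (ler_norm_sum _ _ _) _.
  apply: ler_sum => i _; rewrite normrM normrX normrM normfV normr_nat.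
  by rewrite mulrC ler_wpM2l ?exprn_ge0// ler_piMl.
have mphi : measurable_fun setT phi.
  by apply: (measurable_fun_cvg mf) => w _; exact: cphi.
have phile w : `|phi w| <= expR (x * `|X w|).
  have cn : (fun n => `|f n w|) @ \oo --> `|phi w| by apply: cvg_norm; exact: cphi.
  by apply: ler_cvg_to cn (cvg_cst _) _; near=> n; exact: fle.
have iphi : P.-integrable setT (EFin \o phi).
  apply: (@le_integrable _ _ _ _ _ _ _ (EFin \o (fun w => expR (x * `|X w|)))) => //.
  - exact/measurable_EFinP.
  - by move=> w _ /=; rewrite lee_fin [leRHS]ger0_norm ?expR_ge0.
have /fine_cvg : (\int[P]_w (f n w)%:E)%E @[n --> \oo] --> (\int[P]_w phi w)%:E.
  rewrite /Rintegral fineK; last exact: integrable_fin_num.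
  apply: (@dominated_cvg _ _ _ P setT measurableT (fun n w => (f n w)%:E)
    (fun w => (phi w)%:E) (fun w => (expR (x * `|X w|))%:E)) => //.
  - by move=> n; exact/measurable_EFinP.
  - by move=> w _; apply/cvg_EFin; [near=> n|exact: cphi].
  - by move=> n w _; rewrite lee_fin.
apply: cvg_trans; apply: near_eq_cvg; near=> n.
rewrite -[LHS]/(\int[P]_w f n w) /f /pseries /series.
have ipow := fun r => exp_integrable_pow r x0 hx.
have -> : \int[P]_w (\sum_(0 <= i < n) c i / i`!%:R * (t * X w) ^+ i) =
    \int[P]_w (\sum_(0 <= i < n) c i / i`!%:R * t ^+ i * X w ^+ i).
  by apply: eq_Rintegral => w _; apply: eq_bigr => i _; rewrite exprMn mulrA.
rewrite Rintegral_sum_nat => [|i]; last exact: (integrableZl _ _ (ipow i)).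
apply: eq_bigr => i _; rewrite RintegralZl// /mcoef.
by rewrite /=; ring.
Unshelve. all: by end_near. Qed.

Lemma mcoef0 : mcoef 0 = 1.
Proof.
rewrite /mcoef (_ : \int[P]_w _ = 1) ?divr1//.
under eq_Rintegral do rewrite expr0.
by rewrite Rintegral_cst// -[X in _ * X]/(fine (P setT)) probability_setT mulr1.
Qed.

Lemma mcoef_bounded (x : R) : 0 < x -> exp_integrable x -> coef_bounded mcoef x.
Proof.
move=> x0 hx; exists (\int[P]_w expR (x * `|X w|)) => r.
have ir := exp_integrable_pow r x0 hx.
rewrite /mcoef normrM normfV normr_nat.
have -> : `|\int[P]_w X w ^+ r| / r`!%:R * x ^+ r =
    (x ^+ r / r`!%:R) * `|\int[P]_w X w ^+ r| by ring.
have K0 : 0 <= x ^+ r / r`!%:R by rewrite divr_ge0// exprn_ge0// ltW.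
apply: (@le_trans _ _ (x ^+ r / r`!%:R * \int[P]_w `|X w ^+ r|)).
  by rewrite ler_wpM2l// le_normr_Rintegral.
have iar : P.-integrable setT (EFin \o (fun w => `|X w ^+ r|)).
  exact: integrable_norm ir.
rewrite -RintegralZl//; apply: le_Rintegral => //.
- exact: (integrableZl _ _ iar).
- move=> w _; have := exp_term_le (x * `|X w|) r.
  have -> : `|x * `|X w| | = x * `|X w| by rewrite normrM normr_id gtr0_norm.
  by rewrite exprMn normrX; apply: le_trans; rewrite mulrAC.
Qed.

(* Even moments suffice: exp |u| <= 2 cosh u, a series with even powers only. *)
Lemma exp_integrable_coef (z y : R) : 0 < z < y ->
  (forall r, P.-integrable setT (EFin \o (fun w => X w ^+ r))) ->
  coef_bounded mcoef y -> exp_integrable z.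
Proof.
move=> /andP[z0 zy] ipow my.
(* The r-th term of 2 cosh(z X). All terms are nonnegative, so the series may be integrated term by
   term. *)
pose u r w := 2 * ((~~ odd r)%:R / r`!%:R * (z * X w) ^+ r).
have u0 r w : 0 <= u r w.
  rewrite /u; case: (boolP (odd r)) => //= ro; first by rewrite !mul0r mulr0.
  by rewrite mulr_ge0// mulr_ge0// ?divr_ge0// exprn_even_ge0.
have uE r w : u r w = 2 * (~~ odd r)%:R / r`!%:R * z ^+ r * X w ^+ r.
  by rewrite /u exprMn; ring.
have iu r : P.-integrable setT (EFin \o u r).
  apply: (@eq_integrable _ _ _ _ _ measurableT _ _ _ (integrableZl measurableT
    (2 * (~~ odd r)%:R / r`!%:R * z ^+ r) (ipow r))) => w _.
  by rewrite /= uE.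
have mu r : measurable_fun setT (u r).
  apply: measurable_funM => //; apply: measurable_funM => //.
  by apply: measurable_funX; apply: measurable_funM.
have cu w : (fun n => \sum_(0 <= r < n) u r w) @ \oo -->
    expR (z * X w) + expR (- (z * X w)).
  have e (v : R) : series (exp_coeff v) @ \oo --> expR v by exact: is_cvg_series_exp_coeff.
  have -> : (fun n => \sum_(0 <= r < n) u r w) =
      (fun n => series (exp_coeff (z * X w)) n + series (exp_coeff (- (z * X w))) n).
    apply/funext => n; rewrite /series /= -big_split/=; apply: eq_bigr => r _.
    rewrite /exp_coeff /= /u exprNn -signr_odd; case: (odd r) => /=.
      by rewrite expr1; ring.
    by rewrite expr0; ring.
  by apply: cvgD; exact: e.
have eu w : ((expR (z * `|X w|))%:E <= \sum_(0 <= r <oo) (u r w)%:E)%E.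
  have -> : (\sum_(0 <= r <oo) (u r w)%:E)%E = (expR (z * X w) + expR (- (z * X w)))%:E.
    apply: cvg_lim => //.
    have -> : (fun n => \sum_(0 <= r < n) (u r w)%:E)%E =
        (fun n => (\sum_(0 <= r < n) u r w)%:E).
      by apply/funext => n; rewrite sumEFin.
    by apply: cvg_EFin; [near=> n|exact: cu].
  rewrite lee_fin; have [X0|X0] := leP 0 (X w).
    by rewrite ger0_norm// lerDl expR_ge0.
  by rewrite ltr0_norm// mulrN lerDr expR_ge0.
apply/integrableP; split; first exact/measurable_EFinP/measurable_expRX.
have [S S0 HS] : exists2 S, 0 <= S & forall n, \sum_(i < n) `|mcoef i| * z ^+ i <= S.
  by apply: coef_bounded_sum my _; rewrite ltW.
apply: (@le_lt_trans _ _ (\int[P]_w \sum_(0 <= r <oo) (u r w)%:E)%E).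
  apply: ge0_le_integral => //.
  - by apply/measurable_EFinP; apply: measurableT_comp => //; exact: measurable_expRX.
  - by apply: ge0_emeasurable_sum => [r w _ _|r _]; [rewrite lee_fin|exact/measurable_EFinP].
  - by move=> w _; rewrite /= ger0_norm ?expR_ge0.
rewrite integral_nneseries//; last 2 first.
- by move=> r; exact/measurable_EFinP.
- by move=> r w _; rewrite lee_fin.
apply: (@le_lt_trans _ _ (2 * S)%:E); last exact: ltry.
apply: lime_le; first by apply: is_cvg_nneseries => r _ _; apply: integral_ge0 => w _; rewrite lee_fin.
near=> n; rewrite big_mkord.
apply: (@le_trans _ _ (\sum_(i < n) (2 * (`|mcoef i| * z ^+ i))%:E)%E); last first.
  by rewrite sumEFin lee_fin -mulr_sumr ler_wpM2l.
apply: lee_sum => i _.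
rewrite -[leLHS]fineK; last exact: (integrable_fin_num measurableT (iu i)).
rewrite lee_fin -[leLHS]/(\int[P]_w u i w).
under eq_Rintegral do rewrite uE.
rewrite RintegralZl//.
have -> : 2 * (~~ odd i)%:R / i`!%:R * z ^+ i * (\int[P]_x X x ^+ i) =
  2 * ((~~ odd i)%:R * mcoef i * z ^+ i) by rewrite /mcoef; ring.
rewrite ler_wpM2l// ler_wpM2r ?exprn_ge0 ?(ltW z0)//.
by case: (odd i); rewrite /= ?mul0r// mul1r ler_norm.
Unshelve. all: by end_near. Qed.

(** The disc is enlarged here: [x] is unrelated to the radius [y] of the integrability hypothesis,
    which only supplies the existence of all moments. The relation to [b] bounds the moments on
    every disc smaller than [x], and this makes exp(z |X|) integrable for some z > |t|. *)
Lemma charfun_exp_rel (b : nat -> R) (x t : R) : exp_rel b mcoef ->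
  (exists2 y, 0 < y & exp_integrable y) -> coef_bounded b x -> `|t| < x ->
  let u := psum (fun r => b r * reI r) t in
  let w := psum (fun r => b r * imI r) t in
  \int[P]_v cos (t * X v) = expR u * cos w /\
  \int[P]_v sin (t * X v) = expR u * sin w.
Proof.
move=> ba [y0 y00 hy0] bx tx u w; have t0 : 0 <= `|t| by [].
have x0 : 0 < x by apply: le_lt_trans tx.
(* Here |t| < z < y < x: radius is lost once from [b] to the moments and once from the moments to
   the exponential integral. *)
pose y := (`|t| + 2 * x) / 3; pose z := (2 * `|t| + x) / 3.
have my : coef_bounded mcoef y.
  by apply: exp_rel_coef_bounded ba bx _; rewrite /y; lra.
have by' : coef_bounded b y by apply: coef_bounded_le bx; rewrite /y; lra.
have hz : exp_integrable z.
  apply: exp_integrable_coef my => [|r]; first by rewrite /z /y; lra.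
  exact: exp_integrable_pow y00 hy0.
have z0 : 0 < z by rewrite /z; lra.
have ty : `|t| < y by rewrite /y; lra.
have [] := psum_exp_rel ba by' my ty _ _ reI_le1 imI_le1
  (fun i j => (reIimID i j).1) (fun i j => (reIimID i j).2).
- by rewrite /reI /= mulr1.
- by rewrite /imI /= mul0r.
rewrite -/u -/w => <- <-; split; apply/esym; apply: cvg_lim => //.
- apply: cvg_mcoef z0 hz _ reI_le1 _ => [|v]; first by rewrite /z; lra.
  by have := @is_cvg_series_cos_coeff _ (t * X v); rewrite cosE cos_coeffE.
- apply: cvg_mcoef z0 hz _ imI_le1 _ => [|v]; first by rewrite /z; lra.
  by have := @is_cvg_series_sin_coeff _ (t * X v); rewrite sinE sin_coeffE.
Qed.

Lemma mmt_gen_funE (z : R) : ('M_P X z = \int[P]_w (expR (z * X w))%:E)%E.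
Proof.
rewrite /mmt_gen_fun unlock; apply: eq_integral => w _ /=.
by rewrite mulrC.
Qed.

Lemma mgf_cvg_near0_exp_integrable : mgf_cvg_near0 X ->
  exists2 x, 0 < x & exp_integrable x.
Proof.
move=> /nbhs_ballP[e /= e0 he]; exists (e / 2); first by rewrite divr_gt0.
have e2 : 0 < e / 2 by rewrite divr_gt0.
have hp : ('M_P X (e / 2) < +oo)%E.
  by apply: he; rewrite /ball/= sub0r normrN gtr0_norm//; lra.
have hn : ('M_P X (- (e / 2)) < +oo)%E.
  by apply: he; rewrite /ball/= sub0r opprK gtr0_norm//; lra.
have mz (z : R) : measurable_fun setT (fun w => (expR (z * X w))%:E).
  by apply/measurable_EFinP; apply: measurableT_comp => //; exact: measurable_funM.
apply/integrableP; split; first exact/measurable_EFinP/measurable_expRX.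
apply: (@le_lt_trans _ _ (\int[P]_w ((expR (e / 2 * X w))%:E +
    (expR (- (e / 2) * X w))%:E))%E).
  apply: ge0_le_integral => //.
  - by apply/measurable_EFinP; apply: measurableT_comp => //; exact: measurable_expRX.
  - by apply: emeasurable_funD; exact: mz.
  - move=> w _; rewrite /= ger0_norm ?expR_ge0// -EFinD lee_fin mulNr.
    have [X0|X0] := leP 0 (X w); first by rewrite ger0_norm// lerDl expR_ge0.
    by rewrite ltr0_norm// mulrN lerDr expR_ge0.
by rewrite ge0_integralD// -!mmt_gen_funE lte_add_pinfty.
Qed.

Lemma integrable_mgf_cvg_near0 : mgf_cvg_near0 X -> P.-integrable setT (EFin \o X).
Proof.
move=> /mgf_cvg_near0_exp_integrable[x x0 hx].
by have := exp_integrable_pow 1 x0 hx; apply: eq_integrable => // v _; rewrite /= expr1.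
Qed.

Lemma near0_mgf (x : R) : 0 < x -> exp_integrable x -> forall z, `|z| < x ->
  fine ('M_P X z) = psum mcoef z.
Proof.
move=> x0 hx z zx; rewrite mmt_gen_funE; apply/esym; apply: cvg_lim => //.
have := @cvg_mcoef x z (fun=> 1) (fun w => expR (z * X w)) x0 hx (ltW zx).
have -> : (fun r => mcoef r * 1) = mcoef by apply/funext => r; rewrite mulr1.
apply; first by move=> _; rewrite normr1.
move=> w; have := @is_cvg_series_exp_coeff _ (z * X w).
have -> : (fun r => 1 / r`!%:R) = (fun r => r`!%:R^-1 : R).
  by apply/funext => r; rewrite div1r.
by rewrite expRE exp_coeffE.
Qed.

(** Existence makes the [xget] in [cumulant] return a genuine expansion. The formal logarithm of the
    moment series is one expansion of log E[e^(zX)], and by uniqueness of coefficients every other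
    one coincides with it from index 1 on. *)
Lemma is_cumulants_exp_rel : mgf_cvg_near0 X ->
  (exists k, is_cumulants X k) /\
  (forall k, is_cumulants X k -> exp_rel (egf k) mcoef).
Proof.
move=> /mgf_cvg_near0_exp_integrable[x x0 hx].
have mx := mcoef_bounded x0 hx.
have [b [ba [y y0 by']]] := exp_rel_exists x0 mcoef0 mx.
have [b0 _ _] := ba.
pose m := Num.min x y; have m0 : 0 < m by rewrite lt_min x0.
have mm : coef_bounded mcoef m by apply: coef_bounded_le mx; rewrite (ltW m0) ge_min lexx.
have bm : coef_bounded b m by apply: coef_bounded_le by'; rewrite (ltW m0) ge_min lexx orbT.
have lnM z : `|z| < m -> ln (fine ('M_P X z)) = psum b z.
  move=> zm; rewrite (near0_mgf x0 hx); last by rewrite (lt_le_trans zm)// ge_min lexx.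
  (* The signs (1, 0) in place of ([reI], [imI]) specialise the exponential formula to a real
     argument. *)
  have [] := @psum_exp_rel _ b mcoef (fun=> 1) (fun=> 0) m z ba bm mm zm erefl erefl.
  - by move=> _; rewrite normr1.
  - by move=> _; rewrite normr0.
  - by move=> _ _; rewrite mulr1 mulr0 subr0.
  - by move=> _ _; rewrite mulr0 mul0r addr0.
  have -> : (fun r => mcoef r * 1) = mcoef by apply/funext => r; rewrite mulr1.
  have -> : (fun r => b r * 1) = b by apply/funext => r; rewrite mulr1.
  have -> : psum (fun r => b r * 0) z = 0.
    by apply: cvg_lim => //; rewrite /pseries /series /=;
      under eq_fun do (under eq_bigr do rewrite mulr0 mul0r; rewrite big1_eq);
      exact: cvg_cst.
  by rewrite cos0 mulr1 => -> _; rewrite expRK.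
have egfE k z : (fun n => \sum_(1 <= r < n) k r / r`!%:R * z ^+ r) = pseries (egf k) z.
  apply/funext => -[|n]; rewrite /pseries /series /=; first by rewrite !big_geq.
  by rewrite [RHS]big_nat_recl//= mul0r add0r big_add1.
have cumE k : is_cumulants X k <->
    \forall z \near (0 : R), pseries (egf k) z @ \oo --> ln (fine ('M_P X z)).
  by split; apply: filterS => z; rewrite egfE.
have cumb : is_cumulants X (fun r => b r * r`!%:R).
  apply/cumE; near=> z; have zm : `|z| < m by near: z; exact: near0_norm_lt.
  rewrite lnM//; have -> : egf (fun r => b r * r`!%:R) = b.
    by apply/funext => -[|r]; rewrite /egf ?b0// mulfK// pnatr_eq0 -lt0n fact_gt0.
  exact: cvg_psum bm zm.
split; first by exists (fun r => b r * r`!%:R).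
move=> k kk; suff -> : egf k = b by [].
have /nbhs_ballP[e /= e0 he] := (cumE k).1 kk.
pose z0 := Num.min e m / 2.
have z00 : 0 < z0 by rewrite divr_gt0// lt_min e0.
have z0e : z0 < e by rewrite ltr_pdivrMr// gt_min; apply/orP; left; lra.
have z0m : z0 < m by rewrite ltr_pdivrMr// gt_min; apply/orP; right; lra.
(* Convergence at the single point [z0] bounds the terms there, which puts [egf k] in the scope of
   [psum_inj]. *)
have sz : coef_bounded (egf k) z0.
  have cz : cvgn (pseries (egf k) z0).
    by apply/cvg_ex; eexists; apply: he; rewrite /ball/= sub0r normrN gtr0_norm.
  have [M [_ HM]] := cvg_series_bounded cz.
  exists (M + 1) => i; have := HM (M + 1); rewrite ltrDl ltr01 => /(_ erefl i I).
  by rewrite /= normrM normrX (gtr0_norm z00).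
have bz : coef_bounded b z0 by apply: coef_bounded_le bm; rewrite !ltW.
apply/funext; apply: (psum_inj z00 sz bz); near=> z.
have zm : `|z| < m by near: z; exact: near0_norm_lt.
have ze : `|z| < e by near: z; exact: near0_norm_lt.
rewrite -lnM//; apply: cvg_lim => //.
by apply: he; rewrite /ball/= sub0r normrN.
Unshelve. all: by end_near. Qed.

Lemma cumulant_exp_rel : mgf_cvg_near0 X -> exp_rel (egf (cumulant X)) mcoef.
Proof.
move=> hX; have [ex hk] := is_cumulants_exp_rel hX; apply: hk.
exact: (@xgetPex _ _ [set k : nat -> R | is_cumulants X k]).
Qed.

(** Coefficient 1 of the relation a' = b' a reads 2 a_2 = b_1 a_1 + 2 b_2, and a_1 = 0 by
    centering. *)
Lemma cumulant2 : mgf_cvg_near0 X -> ('E_P[X] = 0)%E ->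
  ('V_P[X] = (cumulant X 2)%:E)%E.
Proof.
move=> hX EX; have [b0 _ ba] := cumulant_exp_rel hX.
have [x x0 hx] := mgf_cvg_near0_exp_integrable hX.
have i1 := exp_integrable_pow 1 x0 hx; have i2 := exp_integrable_pow 2 x0 hx.
have m1 : mcoef 1 = 0.
  rewrite /mcoef /Rintegral; under eq_integral do rewrite expr1.
  by move: EX; rewrite unlock => ->; rewrite mul0r.
have := ba 1%N; rewrite /conv /pseries_diffs !big_ord_recr big_ord0/= m1 mcoef0.
rewrite mulr0 !add0r mulr1 => /(mulfI _)/wrap[]; first by rewrite pnatr_eq0.
rewrite /mcoef => h.
rewrite /variance unlock EX/= unlock.
transitivity (\int[P]_w (X w ^+ 2)%:E)%E.
  by apply: eq_integral => w _; rewrite !fctE/= subr0.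
rewrite -[LHS]fineK; last exact: (integrable_fin_num measurableT i2).
by congr EFin; apply: (mulIf _ h); rewrite invr_eq0 pnatr_eq0.
Qed.

End moments.

(** * The standard normal law as a random variable, its cumulants and characteristic function *)

Section normal_law.
Context {R : realType}.
Local Notation mu := (@lebesgue_measure R).
Local Notation nu := (normal_prob (0 : R) 1).

Lemma ge0_integral_normal_prob (f : R -> \bar R) : measurable_fun setT f ->
  (forall x, 0 <= f x)%E ->
  (\int[nu]_x f x = \int[mu]_x (f x * (normal_pdf 0 1 x)%:E))%E.
Proof.
move=> mf f0.
have numu := @normal_prob_dominates R 0 1.
rewrite -(Radon_Nikodym_SigmaFinite.change_of_variables numu f0 measurableT mf).
apply: ae_eq_integral => //.
- apply: emeasurable_funM => //; apply: (measurable_int mu).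
  exact: Radon_Nikodym_SigmaFinite.f_integrable.
- apply: emeasurable_funM => //; apply/measurable_EFinP.
  exact: measurable_normal_pdf.
- apply: ae_eqe_mul2l; apply: integral_ae_eq => //.
  + exact: Radon_Nikodym_SigmaFinite.f_integrable.
  + by apply/measurable_EFinP; exact: measurable_normal_pdf.
  + move=> E _ mE; rewrite -Radon_Nikodym_SigmaFinite.f_integral//.
Qed.

(** The identity, typed so that it becomes a random variable on the line under [nu]; the lemmas
    about random variables then serve both laws that are compared. *)
Definition id_real (x : measurableTypeR R) : R := x.

Let measurable_id_real : measurable_fun setT id_real.
Proof. exact: measurable_id. Qed.

HB.instance Definition _ := isMeasurableFun.Build _ _ _ _ id_real measurable_id_real.

Definition normal_id : {RV nu >-> R} := id_real.

Lemma normal_pdf01 (x : R) : normal_pdf 0 1 x = normal_peak 1 * expR (- x ^+ 2 / 2).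
Proof.
by rewrite normal_pdfE ?oner_eq0// /normal_fun subr0 expr1n.
Qed.

Lemma mgf_normal (z : R) : ('M_nu normal_id z = (expR (z ^+ 2 / 2))%:E)%E.
Proof.
rewrite mmt_gen_funE ge0_integral_normal_prob; last 2 first.
- by apply/measurable_EFinP; apply: measurableT_comp => //; exact: measurable_funM.
- by move=> x; rewrite lee_fin expR_ge0.
(* Completing the square: the tilted density is a multiple of the normal density of mean [z]. *)
transitivity (\int[mu]_x ((expR (z ^+ 2 / 2))%:E * (normal_pdf z 1 x)%:E))%E.
  apply: eq_integral => x _; rewrite -!EFinM; congr EFin.
  rewrite normal_pdf01 (normal_pdfE z) ?oner_eq0// /normal_fun expr1n.
  rewrite mulrCA [RHS]mulrCA; congr (_ * _); rewrite -!expRD; congr expR.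
  by move: (x : R) => y; rewrite -[normal_id y]/(y : R); field.
rewrite integralZl//; last exact: integrable_normal_pdf.
by rewrite integral_normal_pdf mule1.
Qed.

Lemma mgf_cvg_near0_normal : mgf_cvg_near0 normal_id.
Proof. by near=> z; rewrite mgf_normal ltry. Unshelve. all: by end_near. Qed.

Lemma is_cumulants_normal : is_cumulants normal_id (fun r => (r == 2%N)%:R).
Proof.
near=> z; rewrite mgf_normal/= expRK.
apply: cvg_near_cst; near=> n.
have n3 : (2 < n)%N by near: n; exact: nbhs_infty_gt.
rewrite (big_cat_nat (n := 3))//= big_nat_recr//= big_nat1 /=.
rewrite mul0r mul0r add0r big_nat big1 ?addr0 => [|i /andP[i2 _]].
  by rewrite mul1r mulrC.
by rewrite gtn_eqF// mul0r mul0r.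
Unshelve. all: by end_near. Qed.

(** Obtained from the real moment generating function by the same machinery as for X: the cumulant
    series z^2/2 has bounded terms at every radius, so the formula holds for all [t]. *)
Lemma charfun_normal (t : R) : \int[nu]_x cos (t * x) = expR (- t ^+ 2 / 2) /\
  \int[nu]_x sin (t * x) = 0.
Proof.
pose b : nat -> R := egf (fun r => (r == 2%N)%:R).
have ba : exp_rel b (mcoef normal_id).
  exact: (is_cumulants_exp_rel mgf_cvg_near0_normal).2 is_cumulants_normal.
have b2 : b 2%N = 2^-1 by rewrite /b /egf /= mul1r.
have bN r : r != 2%N -> b r = 0 by case: r => // r r2; rewrite /b /egf (negbTE r2) mul0r.
have bx (x : R) : 0 <= x -> coef_bounded b x.
  move=> x0; exists (x ^+ 2) => r; have [->|/bN ->] := eqVneq r 2%N.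
    by rewrite b2 ger0_norm// ler_piMl ?sqr_ge0// invf_le1// ler1n.
  by rewrite normr0 mul0r sqr_ge0.
clearbody b.
have pe (s : nat -> R) : psum (fun r => b r * s r) t = s 2%N * t ^+ 2 / 2.
  apply: cvg_lim => //; apply: cvg_near_cst; near=> n.
  have n3 : (2 < n)%N by near: n; exact: nbhs_infty_gt.
  rewrite /pseries /series /= big_mkord (bigD1 (Ordinal n3))//= big1 ?addr0 => [|i i2].
    by rewrite b2; ring.
  by rewrite bN ?mul0r//.
have t1 : `|t| < `|t| + 1 by rewrite ltrDl.
have t0 : 0 <= `|t| + 1 by rewrite addr_ge0.
have [] := charfun_exp_rel ba (mgf_cvg_near0_exp_integrable mgf_cvg_near0_normal) (bx _ t0) t1.
rewrite !pe /reI /imI /= => hc hs; split.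
  by rewrite -[LHS]/(\int[nu]_v cos (t * normal_id v)) hc !mul0r cos0 mulr1 expr1 mul1r mulN1r.
by rewrite -[LHS]/(\int[nu]_v sin (t * normal_id v)) hs !mul0r sin0 mulr0.
Unshelve. all: by end_near. Qed.

End normal_law.

(** * Fundamental theorem of calculus and two Laplace transforms *)

Section calculus.
Context {R : realType}.
Local Notation mu := (@lebesgue_measure R).

Lemma is_derive_continuous (F f : R -> R) :
  (forall x : R, is_derive x 1 F (f x)) -> continuous F.
Proof.
move=> Ff x; apply: differentiable_continuous; apply/derivable1_diffP.
by have [] := Ff x.
Qed.

Lemma FTC2_is_derive (F f : R -> R) (a b : R) : a <= b ->
  (forall x : R, is_derive x 1 F (f x)) -> continuous f ->
  (\int[mu]_(x in `[a, b]) (f x)%:E)%E = (F b - F a)%:E.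
Proof.
move=> ab Ff cf; have cF := is_derive_continuous Ff.
move: ab; rewrite le_eqVlt => /predU1P[->|ab].
  by rewrite set_itv1 integral_set1 subrr.
rewrite (@continuous_FTC2 _ f F)//.
- exact: continuous_subspaceT.
- split.
  + by move=> x _; have [] := Ff x.
  + exact/cvg_at_right_filter/cF.
  + exact/cvg_at_left_filter/cF.
- by move=> x _; rewrite derive1E; have [_] := Ff x.
Qed.

Lemma FTC2y_is_derive (F f : R -> R) (a l : R) :
  (forall x : R, is_derive x 1 F (f x)) -> continuous f ->
  (forall x, a <= x -> 0 <= f x) -> F x @[x --> +oo] --> l ->
  (\int[mu]_(x in `[a, +oo[) (f x)%:E)%E = (l - F a)%:E.
Proof.
move=> Ff cf f0 Fl; have cF := is_derive_continuous Ff.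
rewrite (@ge0_continuous_FTC2y _ f F a l)//.
- exact: continuous_subspaceT.
- exact/cvg_at_right_filter/cF.
- by move=> x _; rewrite derive1E; have [_] := Ff x.
Qed.

Lemma cvgy_expRNM (k : R) : 0 < k -> expR (- (k * x)) @[x --> +oo] --> 0.
Proof.
move=> k0; apply: (@cvg_comp _ _ _ (fun x => k * x) (fun x => expR (- x)) _ (pinfty_nbhs R)).
  exact: gt0_cvgMry.
exact: cvgr_expR.
Qed.

Lemma cvgy_MexpRNM (k : R) : 0 < k -> x * expR (- (k * x)) @[x --> +oo] --> 0.
Proof.
move=> k0.
apply: (@squeeze_cvgr _ _ _ _ (cst 0) (fun x => 4 / k * expR (- (k / 2 * x)))).
- near=> x; have x0 : 0 < x by near: x; exact: nbhs_pinfty_gt.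
  rewrite mulr_ge0 ?expR_ge0 ?(ltW x0)//=.
  have -> : - (k * x) = - (k / 2 * x) - (k / 2 * x) by field.
  rewrite expRD mulrA ler_wpM2r ?expR_ge0//.
  have h := expR_ge1Dx (k / 2 * x).
  rewrite expRN ler_pdivrMr ?expR_gt0// -ler_pdivrMl ?divr_gt0//.
  have -> : (4 / k)^-1 * x = k * x / 4 by field; rewrite gt_eqF.
  have : 0 < k * x by rewrite mulr_gt0.
  by move=> kx; apply: le_trans h; lra.
- exact: cvg_cst.
- rewrite -(mulr0 (4 / k)); apply: cvgM; first exact: cvg_cst.
  by apply: cvgy_expRNM; rewrite divr_gt0.
Unshelve. all: by end_near. Qed.

Lemma is_derive_affexp (k x : R) :
  is_derive x 1 (fun x => expR (- (k * x))) (- k * expR (- (k * x))).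
Proof.
have h : is_derive x 1 (fun x : R => - (k * x)) (- k).
  apply: is_derive_eq (is_deriveN (is_derive1M (is_derive_cst k x 1) (is_derive_id x 1))) _.
  by rewrite mul0r add0r mulr1.
by apply: is_derive_eq (is_derive1_comp (is_derive_expR _) h) _; rewrite mulrC.
Qed.

(** Writes the denominator of the Fejer kernel as a superposition of exponentials; [laplace_1Bcos]
    is the integral that remains after exchanging the order. *)
Lemma laplace_id (u : R) : 0 < u ->
  (\int[mu]_(s in `[0%R, +oo[) (s * expR (- (u * s)))%:E = (u ^- 2)%:E)%E.
Proof.
move=> u0; pose F (s : R) := - (u^-1 * (s * expR (- (u * s))) + u ^- 2 * expR (- (u * s))).
have Fd (s : R) : is_derive s 1 F (s * expR (- (u * s))).
  have h1 := is_derive1M (is_derive_cst u^-1 s 1) (is_derive1M (is_derive_id s 1) (is_derive_affexp u s)).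
  have h2 := is_derive1M (is_derive_cst (u ^- 2) s 1) (is_derive_affexp u s).
  apply: is_derive_eq (is_deriveN (is_deriveD h1 h2)) _ => /=.
  by field; rewrite gt_eqF.
rewrite (FTC2y_is_derive Fd _ _ (l := 0)).
- by rewrite /F !(mul0r, mulr0) oppr0 expR0 mulr1 !add0r opprK.
- by move=> s; apply: cvgM; [exact: cvg_id|exact: (is_derive_continuous (is_derive_affexp u))].
- by move=> s s0; rewrite mulr_ge0 ?expR_ge0.
- rewrite -oppr0 /F; apply: cvgN; rewrite -[X in _ --> X](addr0 0).
  apply: cvgD.
    by rewrite -(mulr0 u^-1); apply: cvgM; [exact: cvg_cst|exact: cvgy_MexpRNM].
  by rewrite -(mulr0 (u ^- 2)); apply: cvgM; [exact: cvg_cst|exact: cvgy_expRNM].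
Qed.

Lemma laplace_1Bcos (s : R) : 0 < s ->
  (\int[mu]_(u in `[0%R, +oo[) ((1 - cos u) * expR (- (s * u)))%:E =
   (s * (1 + s ^+ 2))^-1%:E)%E.
Proof.
move=> s0.
have s2 : 0 < 1 + s ^+ 2 by rewrite ltr_pwDl// sqr_ge0.
pose F (u : R) := - (s^-1 * expR (- (s * u)) +
  (1 + s ^+ 2)^-1 * (expR (- (s * u)) * (sin u - s * cos u))).
have sc (u : R) : is_derive u 1 (fun u => sin u - s * cos u) (cos u + s * sin u).
  have h := is_deriveB (is_derive_sin u) (is_derive1M (is_derive_cst s u 1) (is_derive_cos u)).
  by apply: is_derive_eq h _; rewrite /=; ring.
have Fd (u : R) : is_derive u 1 F ((1 - cos u) * expR (- (s * u))).
  have h1 := is_derive1M (is_derive_cst s^-1 u 1) (is_derive_affexp s u).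
  have h2 := is_derive1M (is_derive_cst (1 + s ^+ 2)^-1 u 1) (is_derive1M (is_derive_affexp s u) (sc u)).
  apply: is_derive_eq (is_deriveN (is_deriveD h1 h2)) _ => /=.
  by field; rewrite !gt_eqF.
rewrite (FTC2y_is_derive Fd _ _ (l := 0)).
- congr EFin; rewrite /F mulr0 oppr0 expR0 cos0 sin0; field.
  by rewrite !gt_eqF// mulr_gt0.
- move=> u; apply: cvgM; last exact: (is_derive_continuous (is_derive_affexp s)).
  by apply: cvgB; [exact: cvg_cst|exact: continuous_cos].
- by move=> u u0; rewrite mulr_ge0 ?expR_ge0// subr_ge0 cos_le1.
- rewrite -oppr0 /F; apply: cvgN; rewrite -[X in _ --> X](addr0 0).
  apply: cvgD.
    by rewrite -(mulr0 s^-1); apply: cvgM; [exact: cvg_cst|exact: cvgy_expRNM].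
  rewrite -(mulr0 (1 + s ^+ 2)^-1); apply: cvgM; first exact: cvg_cst.
  apply/norm_cvg0P.
  apply: (@squeeze_cvgr _ _ _ _ (cst 0) (fun u => (1 + s) * expR (- (s * u)))).
  + near=> u; rewrite normr_ge0/= normrM (ger0_norm (expR_ge0 _)) mulrC.
    rewrite ler_wpM2r ?expR_ge0//; apply: le_trans (ler_normB _ _) _.
    rewrite normrM (gtr0_norm s0) lerD//.
      by rewrite ler_norml sin_geN1 sin_le1.
    by rewrite ler_piMr ?(ltW s0)// ler_norml cos_geN1 cos_le1.
  + exact: cvg_cst.
  + by rewrite -(mulr0 (1 + s)); apply: cvgM; [exact: cvg_cst|exact: cvgy_expRNM].
Unshelve. all: by end_near. Qed.

End calculus.

Lemma integrable_cst_in d (T : measurableType d) (R : realType)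
    (m : {measure set T -> \bar R}) (B : set T) (k : R) :
  measurable B -> (m B < +oo)%E -> m.-integrable B (EFin \o cst k).
Proof.
move=> mB Boo; apply/integrableP; split; first exact/measurable_EFinP/measurable_cst.
rewrite -[X in (X < _)%E]/(\int[m]_(x in B) (cst `|k|%:E x))%E.
by rewrite integral_cst// lte_mul_pinfty.
Qed.

(** * Tonelli and Fubini on rectangles, by extension with zero *)

Section iterated.
Context d1 d2 (T1 : measurableType d1) (T2 : measurableType d2) (R : realType).
Variable m1 : {sigma_finite_measure set T1 -> \bar R}.
Variable m2 : {sigma_finite_measure set T2 -> \bar R}.
Variables (A : set T1) (B : set T2).
Hypotheses (mA : measurable A) (mB : measurable B).
Local Open Scope ereal_scope.

Lemma iterated_patch12 (f : T1 * T2 -> \bar R) :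
  \int[m1]_x \int[m2]_y (f \_ (A `*` B)) (x, y) =
  \int[m1]_(x in A) \int[m2]_(y in B) f (x, y).
Proof.
rewrite [RHS]integral_mkcond; apply: eq_integral => x _.
rewrite patchE; case: ifPn => xA.
  rewrite [RHS]integral_mkcond; apply: eq_integral => y _.
  by rewrite !patchE in_setX xA.
by apply: integral0_eq => y _; rewrite patchE in_setX (negbTE xA).
Qed.

Lemma iterated_patch21 (f : T1 * T2 -> \bar R) :
  \int[m2]_y \int[m1]_x (f \_ (A `*` B)) (x, y) =
  \int[m2]_(y in B) \int[m1]_(x in A) f (x, y).
Proof.
rewrite [RHS]integral_mkcond; apply: eq_integral => y _.
rewrite patchE; case: ifPn => yB.
  rewrite [RHS]integral_mkcond; apply: eq_integral => x _.
  by rewrite !patchE in_setX yB andbT.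
by apply: integral0_eq => x _; rewrite patchE in_setX (negbTE yB) andbF.
Qed.

Lemma measurable_patchX (f : T1 * T2 -> \bar R) : measurable_fun setT f ->
  measurable_fun setT (f \_ (A `*` B)).
Proof.
move=> mf; apply/(measurable_restrictT f); first exact: measurableX.
exact: measurable_funTS.
Qed.

Lemma tonelli_in (f : T1 * T2 -> \bar R) : measurable_fun setT f ->
  (forall x y, A x -> B y -> 0 <= f (x, y)) ->
  \int[m1]_(x in A) \int[m2]_(y in B) f (x, y) =
  \int[m2]_(y in B) \int[m1]_(x in A) f (x, y).
Proof.
move=> mf f0; rewrite -iterated_patch12 -iterated_patch21.
apply: fubini_tonelli; first exact: measurable_patchX.
move=> [x y]; rewrite patchE; case: ifPn => //.
by rewrite in_setX => /andP[]; rewrite !inE; exact: f0.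
Qed.

(** A dominating function of the first variable alone and a finite measure of [B] make [f]
    integrable on the rectangle. In both uses [B] is ]0, 1], the range of the scaled frequency. *)
Lemma Fubini_in (f : T1 * T2 -> R) (h : T1 -> R) :
  measurable_fun setT f -> m2 B < +oo -> m1.-integrable A (EFin \o h) ->
  (forall x y, A x -> B y -> `|f (x, y)| <= h x)%R ->
  [/\ m1.-integrable A (EFin \o (fun x => \int[m2]_(y in B) f (x, y))%R),
      m2.-integrable B (EFin \o (fun y => \int[m1]_(x in A) f (x, y))%R) &
      (\int[m1]_(x in A) \int[m2]_(y in B) f (x, y) =
       \int[m2]_(y in B) \int[m1]_(x in A) f (x, y))%R].
Proof.
move=> mf B_fin hA fh.
have mf2 x : measurable_fun setT (fun y => f (x, y)) by exact: measurable_fun_pair2.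
have mf1 y : measurable_fun setT (fun x => f (x, y)) by exact: measurable_fun_pair1.
have if2 x : A x -> m2.-integrable B (EFin \o (fun y => f (x, y))).
  move=> Ax; apply: (@le_integrable _ _ _ _ _ _ _ (EFin \o cst (h x))) => //.
  - exact/measurable_EFinP/measurable_funTS.
  - move=> y By; rewrite /= lee_fin [leRHS]ger0_norm ?fh//.
    exact: le_trans (normr_ge0 _) (fh _ _ Ax By).
  - exact: integrable_cst_in.
have if1 y : B y -> m1.-integrable A (EFin \o (fun x => f (x, y))).
  move=> By; apply: le_integrable hA => //.
  - exact/measurable_EFinP/measurable_funTS.
  - move=> x Ax; rewrite /= lee_fin [leRHS]ger0_norm ?fh//.
    exact: le_trans (normr_ge0 _) (fh _ _ Ax By).
have iF : (m1 \x m2).-integrable setT ((EFin \o f) \_ (A `*` B)).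
  have mF : measurable_fun setT ((EFin \o f) \_ (A `*` B)).
    by apply: measurable_patchX; apply/measurable_EFinP.
  apply/(integrable12ltyP _ _ mF).
  have -> : \int[m1]_x \int[m2]_y `|((EFin \o f) \_ (A `*` B)) (x, y)| =
      \int[m1]_(x in A) \int[m2]_(y in B) `|(f (x, y))%:E|.
    rewrite -(iterated_patch12 (fun z => `|(f z)%:E|)).
    apply: eq_integral => x _; apply: eq_integral => y _.
    by rewrite !patchE; case: ifP => // _; rewrite abse0.
  apply: (@le_lt_trans _ _ (\int[m1]_(x in A) (`|(h x)%:E| * m2 B))).
    apply: ge0_le_integral => //.
    - by move=> x _; apply: integral_ge0.
    - apply: (@measurable_funTS _ _ _ _ A (fun x => \int[m2]_(y in B) `|(f (x, y))%:E|)).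
      have -> : (fun x => \int[m2]_(y in B) `|(f (x, y))%:E|) =
          fubini_F m2 ((fun z => `|(f z)%:E|) \_ (setT `*` B)).
        apply/funext => x; rewrite /fubini_F [LHS]integral_mkcond.
        by apply: eq_integral => y _; rewrite !patchE in_setX in_setT.
      apply: measurable_fun_fubini_tonelli_F; last first.
        by move=> z; rewrite patchE; case: ifP.
      apply/(measurable_restrictT (fun z => `|(f z)%:E|)); first exact: measurableX.
      by apply: measurable_funTS; apply: measurableT_comp => //; exact/measurable_EFinP.
    - apply: emeasurable_funM => //; apply: measurableT_comp => //.
      exact: measurable_int hA.
    - move=> x Ax; rewrite -integral_cst//; apply: ge0_le_integral => //.
      + by apply: measurableT_comp => //; exact/measurable_EFinP/measurable_funTS.
      + by move=> y By; rewrite lee_fin (le_trans (fh _ _ Ax By))// ler_norm.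
  rewrite ge0_integralZr//; last exact: measurableT_comp (measurable_int _ hA).
  by rewrite lte_mul_pinfty ?integral_ge0// ?ge0_fin_numE ?integral_ge0//; case/integrableP : hA.
split.
- rewrite integrable_mkcond//.
  apply: eq_integrable (integrable_fubini_F iF) => // x _.
  rewrite /fubini_F patchE; case: ifPn => [/set_mem Ax|xA].
    rewrite /= /Rintegral fineK ?(integrable_fin_num mB (if2 _ Ax))// [RHS]integral_mkcond.
    by apply: eq_integral => y _; rewrite !patchE in_setX (mem_set Ax).
  by apply: integral0_eq => y _; rewrite patchE in_setX (negbTE xA).
- have GE : (EFin \o (fun y => \int[m1]_(x in A) f (x, y))%R) \_ B =
      fubini_G m1 ((EFin \o f) \_ (A `*` B)).
    apply/funext => y; rewrite /fubini_G patchE; case: ifPn => [/set_mem By|yB].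
      rewrite /= /Rintegral fineK ?(integrable_fin_num mA (if1 _ By))// [LHS]integral_mkcond.
      by apply: eq_integral => x _; rewrite !patchE in_setX (mem_set By) andbT.
    by apply/esym/integral0_eq => x _; rewrite patchE in_setX (negbTE yB) andbF.
  apply: le_integrable (integrable_cst_in (\int[m1]_(x in A) h x)%R mB B_fin) => //.
    apply/(measurable_restrictT _ mB); rewrite GE.
    exact: (measurable_fubini_G iF).
  move=> y By; rewrite /= lee_fin; apply: le_trans (ler_norm _).
  apply: (le_trans (le_normr_Rintegral mA (if1 _ By))).
  apply: le_Rintegral => //; last by move=> x Ax; exact: fh.
  exact: integrable_norm (if1 _ By).
have := Fubini iF; rewrite iterated_patch12 iterated_patch21 => /(congr1 fine) E.
rewrite /Rintegral.
under eq_integral => x /set_mem Ax do rewrite fineK ?(integrable_fin_num mB (if2 _ Ax))//.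
under [in RHS]eq_integral => y /set_mem By do rewrite fineK ?(integrable_fin_num mA (if1 _ By))//.
exact: E.
Qed.

End iterated.

(** * The Fejer kernel, its mass and its primitive *)

Section fejer.
Context {R : realType}.
Local Notation mu := (@lebesgue_measure R).

Lemma measurable_inv : measurable_fun setT (fun x : R => x^-1).
Proof.
have -> : (fun x : R => x^-1) = (fun x => x * powR (x ^+ 2) (-1)).
  apply/funext => x; have [->|x0] := eqVneq x 0; first by rewrite invr0 mul0r.
  by rewrite powR_inv1 ?sqr_ge0// expr2 invfM mulrA divff// mul1r.
apply: measurable_funM => //.
apply: (measurableT_comp (f := fun x : R => powR x (-1)) (g := fun x : R => x ^+ 2)).
  exact: measurable_powR.
exact: exprn_measurable.
Qed.

Lemma ge0_integral_oppr (D : set R) (f : R -> \bar R) : measurable D ->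
  measurable_fun setT f -> (forall r, 0 <= f r)%E ->
  (\int[mu]_(r in D) f r = \int[mu]_(r in -%R @^-1` D) f (- r)%R)%E.
Proof.
move=> mD mf f0.
transitivity (\int[pushforward mu (-%R : _ -> measurableTypeR R)]_(r in D) f r)%E.
  by apply: eq_measure_integral => //= A mA AS; exact/esym/lebesgue_measureN.
by rewrite ge0_integral_pushforward//=; apply: measurable_funTS.
Qed.

(** Nonnegative, and the cosine transform of a triangle supported in [0, 1]. At w = 0 division by
    zero gives the value 0 instead of the limit 1/2, which integrals do not see. *)
Definition fejer (w : R) := (1 - cos w) / w ^+ 2.

Lemma fejer_ge0 w : 0 <= fejer w.
Proof. by rewrite divr_ge0 ?sqr_ge0// subr_ge0 cos_le1. Qed.

Lemma fejerN w : fejer (- w) = fejer w.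
Proof. by rewrite /fejer cosN sqrrN. Qed.

Lemma fejer_le w : fejer w <= 2 / w ^+ 2.
Proof.
rewrite ler_wpM2r ?invr_ge0 ?sqr_ge0//.
by have := cos_geN1 w; lra.
Qed.

Lemma measurable_fejer : measurable_fun setT fejer.
Proof.
apply: measurable_funM.
  by apply: measurable_funB => //; exact: (continuous_measurable_fun (@continuous_cos R)).
apply: (measurableT_comp (f := fun x : R => x^-1) (g := fun x : R => x ^+ 2)).
  exact: measurable_inv.
exact: exprn_measurable.
Qed.

(** Replacing 1/u^2 by the integral of s exp(- u s) and exchanging the order leaves the integral of
    1/(1 + s^2) over the half-line. *)
Lemma integral0y_fejer : (\int[mu]_(u in `[0%R, +oo[) (fejer u)%:E = (pi / 2)%:E)%E.
Proof.
pose f (z : R * R) := ((1 - cos z.1) * (z.2 * expR (- (z.1 * z.2))))%:E.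
have mf : measurable_fun setT f.
  apply/measurable_EFinP; apply: measurable_funM.
    apply: measurable_funB => //.
    exact: (measurableT_comp (continuous_measurable_fun (@continuous_cos R)) measurable_fst).
  apply: measurable_funM => //; apply: measurableT_comp => //.
  by apply: measurableT_comp => //; apply: measurable_funM.
have f0 u s : `[0%R, +oo[%classic u -> `]0%R, +oo[%classic s -> (0 <= f (u, s))%E.
  rewrite /= !in_itv/= !andbT => u0 s0; rewrite lee_fin mulr_ge0 ?subr_ge0 ?cos_le1//.
  by rewrite mulr_ge0 ?expR_ge0 ?(ltW s0).
have := @tonelli_in _ _ _ _ R mu mu `[0%R, +oo[ `]0%R, +oo[ _ _ f mf f0.
move=> /(_ (measurable_itv _) (measurable_itv _)).
have -> : (\int[mu]_(u in `[0%R, +oo[) \int[mu]_(s in `]0%R, +oo[) f (u, s) =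
    \int[mu]_(u in `[0%R, +oo[) (fejer u)%:E)%E.
  apply: eq_integral => u; rewrite inE/= in_itv/= andbT => u0.
  rewrite integral_itv_obnd_cbnd; last first.
    by apply: measurable_funTS; exact: measurable_fun_pair2.
  rewrite /f /=; under eq_integral do rewrite EFinM.
  rewrite ge0_integralZl//.
  (* [laplace_id] needs u > 0; at u = 0 both sides vanish through the factor 1 - cos u. *)
  - move: u0; rewrite le_eqVlt => /predU1P[<-|u0].
      by rewrite cos0 subrr mul0e /fejer cos0 subrr mul0r.
    by rewrite laplace_id.
  - apply/measurable_EFinP; apply: measurable_funM => //; apply: measurable_funTS.
    by apply: measurableT_comp => //; apply: measurableT_comp => //.
  - by move=> s /=; rewrite in_itv/= andbT => s0; rewrite lee_fin mulr_ge0 ?expR_ge0.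
move=> ->; rewrite -integral0y_oneDsqr -[RHS]integral_itv_obnd_cbnd; last first.
  apply/measurable_EFinP; apply: measurable_funTS.
  by apply: continuous_measurable_fun; exact: continuous_oneDsqrV.
apply: eq_integral => s; rewrite inE/= in_itv/= andbT => s0.
transitivity (s%:E * \int[mu]_(u in `[0%R, +oo[) ((1 - cos u) * expR (- (s * u)))%:E)%E.
  rewrite -ge0_integralZl//.
  - by apply: eq_integral => u _; rewrite /f /= -EFinM (mulrC u); congr EFin; ring.
  - apply/measurable_EFinP/measurable_funTS; apply: measurable_funM.
      by apply: measurable_funB => //; exact: (continuous_measurable_fun (@continuous_cos R)).
    by apply: measurableT_comp => //; apply: measurableT_comp => //.
  - by rewrite lee_fin ltW.
rewrite laplace_1Bcos// -EFinM; congr EFin; rewrite /oneDsqr.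
have : 1 + s ^+ 2 != 0 by rewrite gt_eqF// ltr_pwDl// sqr_ge0.
by move=> h; field; rewrite h gt_eqF.
Qed.

Lemma integralNy0_fejer : (\int[mu]_(u in `]-oo, 0%R]) (fejer u)%:E = (pi / 2)%:E)%E.
Proof.
rewrite -integral0y_fejer (@ge0_integration_by_substitution0 R (EFin \o fejer)).
- by apply: eq_integral => u _; rewrite /= fejerN.
- by apply/measurable_EFinP; exact: measurable_fejer.
- by move=> u; rewrite lee_fin fejer_ge0.
Qed.

Lemma integral_fejer : (\int[mu]_u (fejer u)%:E = pi%:E)%E.
Proof.
have mf := measurable_fejer.
rewrite -set_itvNyy (@itv_bndbnd_setU _ _ _ (BRight (0 : R)))// ge0_integral_setU//.
- rewrite integralNy0_fejer integral_itv_obnd_cbnd ?integral0y_fejer.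
    by rewrite -EFinD -splitr.
  by apply/measurable_EFinP; exact: measurable_funTS.
- by apply/measurable_EFinP; exact: measurable_funTS.
- by move=> u _; rewrite lee_fin fejer_ge0.
- apply/disj_setPS => y [/=]; rewrite 2!in_itv/= andbT => y0 y1.
  by move: y1; rewrite ltNge y0.
Qed.

Lemma integrable_fejer : mu.-integrable setT (EFin \o fejer).
Proof.
apply/integrableP; split; first by apply/measurable_EFinP; exact: measurable_fejer.
under eq_integral do rewrite /= ger0_norm ?fejer_ge0//.
by rewrite integral_fejer ltry.
Qed.

(** The primitive of [fejer] vanishing at 0, in Fourier form. Being a superposition of sin(s u), it
    turns into characteristic functions when u is random and the expectation is taken. *)
Definition dirichlet (u : R) : R :=
  \int[mu]_(s in `]0, 1]) ((1 - s) / s * sin (s * u)).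

Lemma fejerE w : w != 0 -> \int[mu]_(s in `]0, 1]) ((1 - s) * cos (s * w)) = fejer w.
Proof.
move=> w0; pose F (s : R) := (1 - s) * (w^-1 * sin (s * w)) - w ^- 2 * cos (s * w).
have dw (s : R) : is_derive s 1 (fun s => s * w) w.
  apply: is_derive_eq (is_derive1M (is_derive_id s 1) (is_derive_cst w s 1)) _.
  by rewrite mulr0 addr0 mul1r.
have d1s (s : R) : is_derive s 1 (fun s => 1 - s) (-1).
  by have h := is_deriveB (is_derive_cst (1 : R) s 1) (is_derive_id s 1);
    apply: is_derive_eq h _; rewrite sub0r.
have ds (s : R) : is_derive s 1 (fun s => sin (s * w)) (cos (s * w) * w).
  exact: (@is_derive1_comp R sin (fun s => s * w)).
have dc (s : R) : is_derive s 1 (fun s => cos (s * w)) (- sin (s * w) * w).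
  exact: (@is_derive1_comp R cos (fun s => s * w)).
have dF (s : R) : is_derive s 1 F ((1 - s) * cos (s * w)).
  have h := is_deriveB (is_derive1M (d1s s) (is_derive1M (is_derive_cst w^-1 s 1) (ds s)))
    (is_derive1M (is_derive_cst (w ^- 2) s 1) (dc s)).
  by apply: is_derive_eq h _; rewrite /=; field.
have cf : continuous (fun s : R => (1 - s) * cos (s * w)).
  move=> s; apply: cvgM; first exact: (is_derive_continuous d1s).
  exact: (is_derive_continuous dc).
rewrite /Rintegral integral_itv_obnd_cbnd; last first.
  by apply/measurable_EFinP; apply: measurable_funTS; exact: continuous_measurable_fun.
rewrite (FTC2_is_derive ler01 dF cf)/=.
by rewrite /F /fejer subrr subr0 !mul0r !mul1r sin0 cos0; field.
Qed.

Lemma integral_fejer_oc u : 0 <= u -> \int[mu]_(w in `]0, u]) fejer w = dirichlet u.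
Proof.
move=> u0.
have fin_itv (a b : R) : (mu `]a, b]%classic < +oo)%E.
  by rewrite lebesgue_measure_itv/=; case: ifP => _; rewrite ?ltry// -EFinD ltry.
have := @Fubini_in _ _ _ _ R mu mu `]0, u] `]0, 1] (measurable_itv _) (measurable_itv _)
  (fun z => (1 - z.2) * cos (z.2 * z.1)) (cst 1).
move=> /(_ _ (fin_itv _ _) _ _)/wrap[].
- apply: measurable_funM; first exact: measurable_funB.
  apply: (measurableT_comp (continuous_measurable_fun (@continuous_cos R))).
  by apply: measurable_funM.
- by have := @integrable_cst_in _ _ R mu `]0, u] 1 (measurable_itv _) (fin_itv 0 u).
- move=> w s _; rewrite /= in_itv/= => /andP[s0 s1]; rewrite normrM.
  apply: mulr_ile1 => //; first by rewrite ger0_norm; lra.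
  by rewrite ler_norml cos_geN1 cos_le1.
move=> [_ _ E]; transitivity (\int[mu]_(w in `]0, u]) \int[mu]_(s in `]0, 1]) ((1 - s) * cos (s * w))).
  apply: eq_Rintegral => w; rewrite inE/= in_itv/= => /andP[w0 _].
  by rewrite fejerE// gt_eqF.
rewrite E; apply: eq_Rintegral => s; rewrite inE/= in_itv/= => /andP[s0 s1].
have dw (w : R) : is_derive w 1 (fun w => s * w) s.
  apply: is_derive_eq (is_derive1M (is_derive_cst s w 1) (is_derive_id w 1)) _.
  by rewrite mulr1 mul0r add0r.
have ds (w : R) : is_derive w 1 (fun w => sin (s * w)) (cos (s * w) * s).
  exact: (@is_derive1_comp R sin (fun w => s * w)).
have dc (w : R) : is_derive w 1 (fun w => cos (s * w)) (- sin (s * w) * s).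
  exact: (@is_derive1_comp R cos (fun w => s * w)).
have dF (w : R) : is_derive w 1 (fun w => (1 - s) / s * sin (s * w)) ((1 - s) * cos (s * w)).
  apply: is_derive_eq (is_derive1M (is_derive_cst _ w 1) (ds w)) _.
  by rewrite -[cst _ w]/((1 - s) / s); field; rewrite gt_eqF.
have cf : continuous (fun w : R => (1 - s) * cos (s * w)).
  by move=> w; apply: cvgM; [exact: cvg_cst|exact: (is_derive_continuous dc)].
rewrite /Rintegral integral_itv_obnd_cbnd; last first.
  by apply/measurable_EFinP; apply: measurable_funTS; exact: continuous_measurable_fun.
by rewrite (FTC2_is_derive u0 dF cf)/= mulr0 sin0 mulr0 subr0.
Qed.

Lemma norm_sin_le (x : R) : `|sin x| <= `|x|.
Proof.
wlog x0 : x / 0 <= x.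
  move=> h; have [|x0] := leP 0 x; first exact: h.
  by rewrite -(normrN x) -(normrN (sin x)) -sinN h// oppr_ge0 ltW.
have h (y : R) : is_derive y 1 sin (cos y) := is_derive_sin y.
have cs : {within `[0, x], continuous sin} by apply: continuous_subspaceT; exact: continuous_sin.
have [c _] := MVT_segment x0 (fun y _ => h y) cs.
rewrite sin0 !subr0 => ->; rewrite normrM ler_piMl//.
by rewrite ler_norml cos_geN1 cos_le1.
Qed.

(** From the triple angle: 0 = cos(3y) = cos y (1 - 4 sin^2 y) at y = pi/6. *)
Lemma sin_pisixth : sin (pi / 6) = 1 / 2 :> R.
Proof.
set y := pi / 6; have p0 := pi_gt0 R.
have y3 : y + y + y = pi / 2 by rewrite /y; field.
have c0 : 0 < cos y by apply: cos_gt0_pihalf; rewrite /y; apply/andP; split; lra.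
have s0 : 0 < sin y by apply: sin_gt0_pihalf; rewrite /y; apply/andP; split; lra.
have : cos (y + y + y) = 0 by rewrite y3 cos_pihalf.
rewrite cosD [cos (y + y)]cosD [sin (y + y)]sinD -!expr2 cos2sin2 => h.
have {h} : cos y * (1 - 4 * sin y ^+ 2) = 0 by rewrite -[RHS]h; ring.
move/eqP; rewrite mulf_eq0 (gt_eqF c0)/= => /eqP h.
have : (sin y - 1 / 2) * (sin y + 1 / 2) = 0 by lra.
by move/eqP; rewrite mulf_eq0 => /orP[] /eqP; lra.
Qed.

(** From 1/2 = sin(pi/6) <= pi/6. This crude bound suffices for the mass of the kernel, the peak of
    the normal density and the factor 2/pi. *)
Lemma pi_ge3 : 3 <= pi :> R.
Proof.
have := norm_sin_le (pi / 6); have p0 := pi_gt0 R.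
rewrite sin_pisixth !ger0_norm; lra.
Qed.

(** |sin(s u)| <= s |u| removes the singularity of 1/s at 0. *)
Lemma dirichlet_dominated (s u : R) : 0 < s <= 1 ->
  `|(1 - s) / s * sin (s * u)| <= `|u|.
Proof.
move=> /andP[s0 s1]; rewrite normrM normrM normfV (gtr0_norm s0).
rewrite mulrAC ler_pdivrMr// mulrC.
apply: (@le_trans _ _ (`|s * u| * 1)).
  by apply: ler_pM => //; [exact: norm_sin_le|rewrite ger0_norm; lra].
by rewrite mulr1 normrM (gtr0_norm s0) mulrC.
Qed.

Lemma measurable_dirichlet_kernel (u : R) :
  measurable_fun setT (fun s : R => (1 - s) / s * sin (s * u)).
Proof.
apply: measurable_funM.
  by apply: measurable_funM; [exact: measurable_funB|exact: measurable_inv].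
apply: (measurableT_comp (continuous_measurable_fun (@continuous_sin R))).
exact: measurable_funM.
Qed.

Lemma integrable_dirichlet (u : R) :
  mu.-integrable `]0, 1] (EFin \o (fun s : R => (1 - s) / s * sin (s * u))).
Proof.
have fin1 : (mu `]0%R, 1%R]%classic < +oo)%E.
  by rewrite lebesgue_measure_itv/= lte01 -EFinD ltry.
have ic := @integrable_cst_in _ _ R mu `]0, 1] `|u| (measurable_itv _) fin1.
apply: (le_integrable _ _ _ ic) => //.
- by apply/measurable_EFinP; apply: measurable_funTS; exact: measurable_dirichlet_kernel.
- move=> s; rewrite /= in_itv/= => s01.
  by rewrite lee_fin normr_id dirichlet_dominated.
Qed.

Lemma dirichletN (u : R) : dirichlet (- u) = - dirichlet u.
Proof.
apply/esym; rewrite /dirichlet -[LHS]mulN1r -RintegralZl//; last exact: integrable_dirichlet.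
by apply: eq_Rintegral => s _; rewrite mulrN sinN; ring.
Qed.

(* Fourier inversion for the triangle kernel, since fejer is the cosine transform
   of 1 - s on ]0, 1]. *)
Lemma integral_fejer_Nyc (u : R) :
  \int[mu]_(w in `]-oo, u]) fejer w = pi / 2 + dirichlet u.
Proof.
have if_ (i : interval R) : mu.-integrable [set` i] (EFin \o fejer).
  by apply: (integrableS _ _ _ integrable_fejer).
have h0 : \int[mu]_(w in `]-oo, 0]) fejer w = pi / 2.
  by rewrite /Rintegral integralNy0_fejer.
have [u0|u0] := leP 0 u.
  have := @Rintegral_itvB R fejer -oo%O (BRight u) 0 (if_ _).
  rewrite h0 (integral_fejer_oc u0) bnd_simp => /(_ erefl u0) <-.
  by rewrite addrC subrK.
have := @Rintegral_itvB R fejer -oo%O (BRight 0) u (if_ _).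
rewrite h0 bnd_simp => /(_ erefl (ltW u0)) h.
have -> : dirichlet u = - \int[mu]_(w in `]u, 0]) fejer w; last by lra.
have -> : \int[mu]_(w in `]u, 0]) fejer w = \int[mu]_(w in `]0, - u]) fejer w.
  rewrite -Rintegral_itv_bndo_bndc// -[RHS]Rintegral_itv_bndo_bndc//.
  have mf : measurable_fun setT (EFin \o fejer).
    by apply/measurable_EFinP; exact: measurable_fejer.
  have f0 r : (0 <= (EFin \o fejer) r)%E by rewrite lee_fin fejer_ge0.
  have := ge0_integral_oppr (measurable_itv `]u, 0[) mf f0.
  rewrite opp_preimage_itvbndbnd/= oppr0 /Rintegral => ->; congr fine.
  by apply: eq_integral => r _; rewrite /= fejerN.
by rewrite integral_fejer_oc ?oppr_ge0 ?(ltW u0)// dirichletN opprK.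
Qed.

End fejer.

(** * Smoothed distribution functions in terms of characteristic functions *)

Section smoothed_cdf.
Context d (T : measurableType d) (R : realType) (P : probability T R).
Variable X : {RV P >-> R}.
Local Notation mu := (@lebesgue_measure R).

Definition rcdf (a : R) : R := fine (P [set w | X w <= a]).

Lemma measurable_le_set (a : R) : measurable [set w | X w <= a].
Proof.
have -> : [set w | X w <= a] = X @^-1` `]-oo, a] by apply/seteqP; split => w; rewrite /= in_itv.
by rewrite -[_ @^-1` _]setTI; exact: measurable_funP.
Qed.

Lemma rcdf_ge0 a : 0 <= rcdf a. Proof. by rewrite fine_ge0. Qed.

Lemma rcdf_le1 a : rcdf a <= 1.
Proof.
rewrite -lee_fin fineK ?fin_num_measure ?probability_le1//; exact: measurable_le_set.
Qed.

Lemma rcdf_le a b : a <= b -> rcdf a <= rcdf b.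
Proof.
move=> ab; rewrite fine_le ?fin_num_measure//; try exact: measurable_le_set.
by rewrite le_measure ?inE//; try exact: measurable_le_set; move=> w /= /le_trans; exact.
Qed.

Lemma measurable_rcdf_scaled (x tau : R) : 0 < tau ->
  measurable_fun setT (fun w : R => rcdf (x - w / tau)).
Proof.
move=> tau0; apply: nonincreasing_measurable => // a b ab.
by apply: rcdf_le; rewrite lerD2l lerN2 ler_pM2r// invr_gt0.
Qed.

Lemma integrable_fejer_cdf (x tau : R) : 0 < tau ->
  mu.-integrable setT (EFin \o (fun w : R => fejer w * rcdf (x - w / tau))).
Proof.
move=> tau0; apply: (le_integrable _ _ _ (@integrable_fejer R)) => //.
  apply/measurable_EFinP; apply: measurable_funM; first exact: measurable_fejer.
  exact: measurable_rcdf_scaled.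
move=> w _; rewrite /= lee_fin !ger0_norm ?(mulr_ge0 (fejer_ge0 w) (rcdf_ge0 _)) ?fejer_ge0//.
by rewrite ler_piMr ?fejer_ge0 ?rcdf_le1.
Qed.

(** Tonelli for the kernel on the set X v <= x - w/tau, which is also w <= tau (x - X v):
    integrating in v first gives the distribution function, in w first the primitive of the
    kernel. *)
Lemma integral_fejer_cdf (x tau : R) : 0 < tau ->
  (\int[mu]_w (fejer w * rcdf (x - w / tau))%:E =
   \int[P]_v (pi / 2 + dirichlet (tau * (x - X v)))%:E)%E.
Proof.
move=> tau0.
pose f (z : T * R) := (if z.2 <= tau * (x - X z.1) then fejer z.2 else 0)%:E.
have mf : measurable_fun setT f.
  apply/measurable_EFinP; apply: measurable_fun_ifT => //; last first.
    exact: (measurableT_comp (@measurable_fejer R) measurable_snd).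
  apply: measurable_fun_ler => //; apply: measurable_funM => //.
  by apply: measurable_funB => //; exact: measurableT_comp.
have f0 z : (0 <= f z)%E by rewrite lee_fin; case: ifP => // _; exact: fejer_ge0.
have := @fubini_tonelli _ _ _ _ R P mu f mf f0.
have -> : (\int[P]_v \int[mu]_w f (v, w) =
    \int[P]_v (pi / 2 + dirichlet (tau * (x - X v)))%:E)%E.
  apply: eq_integral => v _; set u := tau * (x - X v).
  rewrite -integral_fejer_Nyc /Rintegral fineK; last first.
    apply: (@integrable_fin_num _ _ _ mu `]-oo, u]) => //.
    by apply: (integrableS _ _ _ (@integrable_fejer R)).
  rewrite [RHS]integral_mkcond; apply: eq_integral => w _.
  by rewrite patchE /f /= mem_setE in_itv/=; case: ifP.
move=> ->; apply: eq_integral => w _.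
have -> : (\int[P]_v f (v, w) = \int[P]_v ((fejer w)%:E * (\1_[set v | X v <= x - w / tau] v)%:E))%E.
  apply: eq_integral => v _; rewrite /f /= indicE -EFinM; congr EFin.
  have -> : (w <= tau * (x - X v)) = (v \in [set v | X v <= x - w / tau]).
    have -> : (w <= tau * (x - X v)) = (X v <= x - w / tau).
      by rewrite -ler_pdivrMl// lerBrDl lerBrDr mulrC.
    by apply/idP/idP; rewrite inE.
  by case: (_ \in _); rewrite ?mulr1 ?mulr0.
rewrite ge0_integralZl//; last 2 first.
- by apply/measurable_EFinP; apply: measurable_indic; exact: measurable_le_set.
- by rewrite lee_fin fejer_ge0.
rewrite integral_indic//; last exact: measurable_le_set.
by rewrite setIT EFinM /rcdf fineK// fin_num_measure//; exact: measurable_le_set.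
Qed.

(** This is (1 - s)/s * E[sin(s tau (x - X))], expanded so that the law of X enters only through its
    characteristic function at s tau, hence at frequencies up to tau when s <= 1. *)
Definition smooth_kernel (x tau s : R) : R :=
  (1 - s) / s * (sin (s * tau * x) * \int[P]_v cos (s * tau * X v) -
                 cos (s * tau * x) * \int[P]_v sin (s * tau * X v)).

(** The integrability of X provides the dominating function |tau (x - X)| for exchanging the
    expectation with the integral in s, despite the factor 1/s. *)
Lemma smoothed_cdfE (x tau : R) : 0 < tau -> P.-integrable setT (EFin \o X) ->
  mu.-integrable `]0, 1] (EFin \o smooth_kernel x tau) /\
  \int[mu]_w (fejer w * rcdf (x - w / tau)) =
    pi / 2 + \int[mu]_(s in `]0, 1]) smooth_kernel x tau s.
Proof.
move=> tau0 iX.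
have fin1 : (mu `]0%R, 1%R]%classic < +oo)%E.
  by rewrite lebesgue_measure_itv/= lte01 -EFinD ltry.
pose f (z : T * R) := (1 - z.2) / z.2 * sin (z.2 * (tau * (x - X z.1))).
pose h v := `|tau * (x - X v)|.
have mf : measurable_fun setT f.
  apply: measurable_funM.
    apply: (measurableT_comp (f := fun s : R => (1 - s) / s) (g := snd)) => //.
    by apply: measurable_funM; [exact: measurable_funB|exact: measurable_inv].
  apply: (measurableT_comp (continuous_measurable_fun (@continuous_sin R))).
  apply: measurable_funM => //; apply: measurable_funM => //.
  by apply: measurable_funB => //; exact: measurableT_comp.
have icst (k : R) : P.-integrable setT (EFin \o cst k).
  exact: finite_measure_integrable_cst.
have ih : P.-integrable setT (EFin \o h).
  have i1 : P.-integrable setT (EFin \o (fun v => tau * (x - X v))).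
    have i2 : P.-integrable setT (EFin \o (fun v => x - X v)).
      by have := integrableB measurableT (icst x) iX.
    by have := integrableZl measurableT tau i2.
  exact: integrable_norm i1.
have [] := @Fubini_in _ _ _ _ R P mu setT `]0, 1] measurableT (measurable_itv _) f h mf fin1 ih.
  by move=> v s _; rewrite /= in_itv/= => s01; exact: dirichlet_dominated.
move=> i1 i2 E.
have bdd (g : R -> R) (t : R) : continuous g -> (forall y, `|g y| <= 1) ->
    P.-integrable setT (EFin \o (fun v => g (t * X v))).
  move=> cg g1; apply: (le_integrable _ _ _ (icst 1)) => //.
    apply/measurable_EFinP; apply: (measurableT_comp (continuous_measurable_fun cg)).
    exact: measurable_funM.
  by move=> v _; rewrite /= lee_fin normr1.
have cos1 (y : R) : `|cos y| <= 1 by rewrite ler_norml cos_geN1 cos_le1.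
have sin1 (y : R) : `|sin y| <= 1 by rewrite ler_norml sin_geN1 sin_le1.
have ic t := bdd cos t (@continuous_cos R) cos1.
have is_ t := bdd sin t (@continuous_sin R) sin1.
have kE s : \int[P]_v f (v, s) = smooth_kernel x tau s.
  rewrite /f /smooth_kernel /=.
  have -> : \int[P]_v ((1 - s) / s * sin (s * (tau * (x - X v)))) =
    \int[P]_v ((1 - s) / s * (sin (s * tau * x) * cos (s * tau * X v) -
      cos (s * tau * x) * sin (s * tau * X v))).
    apply: eq_Rintegral => v _; congr (_ * _); rewrite -sinB; congr sin; ring.
  have j1 := integrableZl measurableT (sin (s * tau * x)) (ic (s * tau)).
  have j2 := integrableZl measurableT (cos (s * tau * x)) (is_ (s * tau)).
  rewrite RintegralZl//; last exact: (integrableB measurableT j1 j2).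
  by rewrite RintegralB// !RintegralZl.
split.
  by apply: (eq_integrable _ _ _ _ i2) => // s _; rewrite /= kE.
rewrite {1}/Rintegral integral_fejer_cdf// -[LHS]/(\int[P]_v (pi / 2 + dirichlet (tau * (x - X v)))).
rewrite RintegralD//; last exact: (icst (pi / 2)).
congr (_ + _).
  rewrite Rintegral_cst// -[X in _ * X]/(fine (P setT)) probability_setT mulr1//.
rewrite [LHS]E; apply: eq_Rintegral => s _; exact: kE.
Qed.

End smoothed_cdf.

(** * Averages against the Fejer kernel over a window *)

Section smoothing.
Context {R : realType}.
Local Notation mu := (@lebesgue_measure R).

Lemma integrable_fejer_in (D : set R) : measurable D ->
  mu.-integrable D (EFin \o fejer).
Proof. by move=> mD; apply: (integrableS _ _ _ (@integrable_fejer R)). Qed.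

Lemma fejer_tail (h : R) : 0 < h -> \int[mu]_(w in `]h, +oo[) fejer w <= 2 / h.
Proof.
move=> h0.
have cinv (c : R) : h <= c -> {for c, continuous (fun x : R => 2 / x ^+ 2)}.
  move=> hc; have c0 : c != 0 by rewrite gt_eqF// (lt_le_trans h0).
  apply: cvgM; first exact: cvg_cst.
  apply: (@cvgV _ _ _ _ (fun x : R => x ^+ 2)); first by rewrite expf_neq0.
  exact: exprn_continuous.
have dF (x : R) : x != 0 -> is_derive x 1 (fun x : R => - (2 / x)) (2 / x ^+ 2).
  move=> x0; have h1 := @is_deriveV R (fun x : R => x) x 1 1 x0 (is_derive_id x 1).
  have h2 := is_deriveN (is_derive1M (is_derive_cst (2 : R) x 1) h1).
  by apply: is_derive_eq h2 _; rewrite /GRing.scale/= mul0r add0r mulr1; field.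
have E : (\int[mu]_(x in `[h, +oo[) (2 / x ^+ 2)%:E = (2 / h)%:E)%E.
  rewrite (@ge0_continuous_FTC2y _ _ (fun x => - (2 / x)) h 0).
  - by rewrite -EFinB sub0r opprK.
  - by move=> x hx; rewrite divr_ge0 ?sqr_ge0.
  - apply: continuous_in_subspaceT => x; rewrite inE/= in_itv/= andbT; exact: cinv.
  - rewrite -oppr0; apply: cvgN; rewrite -(mulr0 2); apply: cvgM; first exact: cvg_cst.
    apply/(@gtr0_cvgV0 R R (pinfty_nbhs R) _ (fun x => x)); last exact: cvg_id.
    by near=> x; near: x; exact: nbhs_pinfty_gt.
  - by move=> x hx; have [] := dF x (lt0r_neq0 (lt_trans h0 hx)).
  - have [hd _] := dF h (lt0r_neq0 h0).
    apply: cvg_at_right_filter.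
    by have := @differentiable_continuous _ _ _ _ _ ((derivable1_diffP _ _).1 hd).
  - move=> x; rewrite in_itv/= andbT => hx; rewrite derive1E.
    by have [] := dF x (lt0r_neq0 (lt_trans h0 hx)).
rewrite -lee_fin /Rintegral fineK; last first.
  by apply: (integrable_fin_num _ (integrable_fejer_in _)).
rewrite -E integral_itv_obnd_cbnd; last first.
  by apply/measurable_EFinP; apply: measurable_funTS; exact: measurable_fejer.
apply: ge0_le_integral => //.
- by move=> w _; rewrite lee_fin fejer_ge0.
- by apply/measurable_EFinP; apply: measurable_funTS; exact: measurable_fejer.
- apply/measurable_EFinP; apply: measurable_funTS; apply: measurable_funM => //.
  apply: (measurableT_comp (f := fun x : R => x^-1) (g := fun x : R => x ^+ 2)).
    exact: measurable_inv.
  exact: exprn_measurable.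
- by move=> w _; rewrite lee_fin fejer_le.
Unshelve. all: by end_near. Qed.

Definition fejer_mass (h : R) : R := \int[mu]_(w in `]- h, h]) fejer w.

Lemma fejer_mass_ge (h : R) : 0 < h -> pi - 4 / h <= fejer_mass h <= pi.
Proof.
move=> h0.
have if_ (i : interval R) : mu.-integrable [set` i] (EFin \o fejer).
  exact: integrable_fejer_in.
have := @Rintegral_itvB R fejer -oo%O +oo%O h (if_ _) erefl erefl.
have := @Rintegral_itvB R fejer -oo%O (BRight h) (- h) (if_ _) erefl.
rewrite bnd_simp => /(_ _)/wrap[]; first by rewrite ge0_cp ?ltW.
have -> : \int[mu]_(w in `]-oo, +oo[) fejer w = pi.
  by rewrite set_itvNyy /Rintegral integral_fejer.
rewrite -/(fejer_mass h) !integral_fejer_Nyc.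
rewrite dirichletN => <- tl; have := fejer_tail h0; rewrite -tl => h1.
have : 0 <= \int[mu]_(w in `]h, +oo[) fejer w.
  by apply: Rintegral_ge0 => w _; exact: fejer_ge0.
rewrite -tl; have -> : 4 / h = 2 / h + 2 / h by field; rewrite gt_eqF.
by move=> h2; apply/andP; split; lra.
Qed.

Lemma integrable_fejerM (D : set R) (g : R -> R) (M : R) : measurable D ->
  measurable_fun D g -> (forall w, D w -> `|g w| <= M) ->
  mu.-integrable D (EFin \o (fun w => fejer w * g w)).
Proof.
move=> mD mg gM.
have iM := @integrableZl _ _ R mu D mD M _ (integrable_fejer_in mD).
apply: (le_integrable _ _ _ iM) => //.
  apply/measurable_EFinP; apply: measurable_funM => //.
  by apply: measurable_funTS; exact: measurable_fejer.
move=> w Dw; rewrite /= lee_fin normrM (ger0_norm (fejer_ge0 w)) mulrC.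
rewrite [leRHS]normrM (ger0_norm (fejer_ge0 w)) ler_wpM2r ?fejer_ge0//.
by apply: le_trans (gM _ Dw) _; exact: ler_norm.
Qed.

(** Reflection, under which the kernel is invariant, makes the two integrals equal, and their sum is
    2 h times the mass. *)
Lemma fejer_moment (h : R) : 0 < h ->
  \int[mu]_(w in `]- h, h]) (fejer w * (h - w)) = h * fejer_mass h /\
  \int[mu]_(w in `]- h, h]) (fejer w * (h + w)) = h * fejer_mass h.
Proof.
move=> h0.
have im (g : R -> R) (i : interval R) : measurable_fun setT g ->
    (forall w, w \in i -> `|g w| <= 2 * h) ->
    mu.-integrable [set` i] (EFin \o (fun w => fejer w * g w)).
  by move=> mg gh; apply: (@integrable_fejerM _ _ (2 * h)) => //; exact: measurable_funTS.
have mB : measurable_fun setT (fun w : R => h - w) by exact: measurable_funB.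
have mD : measurable_fun setT (fun w : R => h + w) by exact: measurable_funD.
have iB : mu.-integrable `]- h, h] (EFin \o (fun w => fejer w * (h - w))).
  by apply: im => // w; rewrite in_itv/= => /andP[? ?]; rewrite ler_norml; apply/andP; split; lra.
have iD : mu.-integrable `]- h, h] (EFin \o (fun w => fejer w * (h + w))).
  by apply: im => // w; rewrite in_itv/= => /andP[? ?]; rewrite ler_norml; apply/andP; split; lra.
have eBD : \int[mu]_(w in `]- h, h]) (fejer w * (h - w)) =
    \int[mu]_(w in `]- h, h]) (fejer w * (h + w)).
  (* [ge0_integral_oppr] wants an integrand nonnegative on the whole line; the absolute value
     changes nothing on the window. *)
  have mf : measurable_fun setT (fun w : R => (fejer w * `|h - w|)%:E).
    apply/measurable_EFinP; apply: measurable_funM; first exact: measurable_fejer.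
    exact: measurableT_comp.
  have f0 w : (0 <= (fejer w * `|h - w|)%:E)%E.
    by rewrite lee_fin; apply: mulr_ge0 => //; exact: fejer_ge0.
  have := ge0_integral_oppr (measurable_itv `]- h, h]) mf f0.
  rewrite opp_preimage_itvbndbnd/= opprK => /(congr1 fine) E.
  transitivity (\int[mu]_(w in `]- h, h]) (fejer w * `|h - w|)).
    apply: eq_Rintegral => w; rewrite inE/= in_itv/= => /andP[_ ?].
    by rewrite ger0_norm// subr_ge0.
  rewrite [LHS]E -[LHS]/(\int[mu]_(w in `[- h, h[) (fejer (- w) * `|h - - w|)).
  transitivity (\int[mu]_(w in `[- h, h[) (fejer w * (h + w))).
    apply: eq_Rintegral => w; rewrite inE/= in_itv/= => /andP[? _].
    by rewrite fejerN opprK ger0_norm//; lra.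
  rewrite Rintegral_itv_bndo_bndc; last first.
    by apply: im => // w; rewrite in_itv/= => /andP[? ?]; rewrite ler_norml; apply/andP; split; lra.
  by rewrite -Rintegral_itv_obnd_cbnd.
have := @RintegralD _ _ R mu _ _ _ (measurable_itv _) iB iD.
have -> : \int[mu]_(w in `]- h, h]) (fejer w * (h - w) + fejer w * (h + w)) = 2 * h * fejer_mass h.
  rewrite /fejer_mass -RintegralZl//; last exact: integrable_fejer_in.
  by apply: eq_Rintegral => w _; ring.
by rewrite -eBD => {im iB iD eBD mB mD}; move: (Rintegral _ _ _) => I E; split; nra.
Qed.

(* Integrate e - k (h -/+ w) on ]-h, h] and - D elsewhere; the terms odd in w
   cancel because fejer is even. *)
Lemma fejer_lower_bound (g : R -> R) (h e D k : R) (sgn : bool) : 0 < h ->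
  mu.-integrable setT (EFin \o (fun w => fejer w * g w)) ->
  (forall w, - D <= g w) ->
  (forall w, w \in `]- h, h] -> e - k * (h - (-1) ^+ sgn * w) <= g w) ->
  (e + D) * fejer_mass h - D * pi - k * h * fejer_mass h <=
    \int[mu]_w (fejer w * g w).
Proof.
move=> h0 ig gD gk.
pose A : set (measurableTypeR R) := `]- h, h]%classic.
have mA : measurable A by exact: measurable_itv.
(* [p] is the gain over the global bound - D, so the minorant is - D times the kernel plus a
   correction supported on the window. *)
pose p w := (e + D) - k * (h - (-1) ^+ sgn * w).
have mp : measurable_fun setT p.
  by apply: measurable_funB => //; apply: measurable_funM => //; apply: measurable_funB => //; exact: measurable_funM.
have pb w : A w -> `|p w| <= `|e + D| + `|k| * (2 * h).
  rewrite /A /= in_itv/= => /andP[w1 w2]; apply: le_trans (ler_normB _ _) _.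
  rewrite lerD2l normrM ler_wpM2l// ler_norml.
  by case: sgn {gk mp p} => /=; rewrite ?expr1 ?expr0; apply/andP; split; lra.
have iA : mu.-integrable A (EFin \o (fun w => fejer w * p w)).
  by apply: (integrable_fejerM mA _ pb); exact: measurable_funTS.
have iA' : mu.-integrable setT (EFin \o ((fun w => fejer w * p w) \_ A)).
  by have /integrable_mkcond := iA => /(_ mA); rewrite restrict_EFin.
have iD := integrableZl measurableT (- D) (@integrable_fejer R).
have {}iA2 : mu.-integrable setT (EFin \o (fun w => - D * fejer w + ((fun w => fejer w * p w) \_ A) w)).
  by have := integrableD measurableT iD iA'.
have : \int[mu]_w (- D * fejer w + ((fun w => fejer w * p w) \_ A) w) <= \int[mu]_w (fejer w * g w).
  apply: le_Rintegral => // w _; rewrite patchE; case: ifPn => [/set_mem Aw|_].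
    have := gk w Aw; rewrite /p => hw.
    rewrite (mulrC _ (fejer w)) -mulrDr ler_wpM2l ?fejer_ge0//; lra.
  by rewrite addr0 mulrC ler_wpM2l ?fejer_ge0.
apply: le_trans; rewrite RintegralD// RintegralZl//; last exact: integrable_fejer.
rewrite -Rintegral_mkcond {1}/Rintegral integral_fejer /=.
have m1 : measurable_fun setT (fun w : R => h - (-1) ^+ sgn * w).
  by apply: measurable_funB => //; exact: measurable_funM.
have i1 : mu.-integrable A (EFin \o (fun w => fejer w * (h - (-1) ^+ sgn * w))).
  apply: (@integrable_fejerM _ _ (2 * h)) => //; first exact: measurable_funTS.
  move=> w; rewrite /A /= in_itv/= => /andP[w1 w2]; rewrite ler_norml.
  by case: sgn {gk m1 mp pb iA iA' iA2 p} => /=; rewrite ?expr1 ?expr0; apply/andP; split; lra.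
have -> : \int[mu]_(w in A) (fejer w * p w) =
    \int[mu]_(w in A) ((e + D) * fejer w - k * (fejer w * (h - (-1) ^+ sgn * w))).
  by apply: eq_Rintegral => w _; rewrite /p; ring.
have j1 := @integrableZl _ _ R mu A (measurable_itv _) (e + D) _ (@integrable_fejer_in A (measurable_itv _)).
have j2 := @integrableZl _ _ R mu A (measurable_itv _) k _ i1.
rewrite RintegralB// !RintegralZl//; last exact: integrable_fejer_in.
have -> : \int[mu]_(x in A) (fejer x * (h - (-1) ^+ sgn * x)) = h * fejer_mass h.
  have [f1 f2] := fejer_moment h0; case: sgn {gk m1 mp pb iA iA' iA2 i1 j2 p} => /=; last first.
    by rewrite -f1; apply: eq_Rintegral => w _; rewrite expr0 mul1r.
  by rewrite -f2; apply: eq_Rintegral => w _; rewrite expr1 mulN1r opprK.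
by rewrite -/(fejer_mass h) le_eqVlt; apply/orP; left; apply/eqP; ring.
Qed.

(** Solves the lower bound for [e]: at least three quarters of the kernel's mass lies in the window,
    so the contribution of [D] comes back with the factor 1/3 only. *)
Lemma fejer_upper_bound (g : R -> R) (e D k eta : R) (sgn : bool) :
  0 <= D -> 0 <= eta ->
  mu.-integrable setT (EFin \o (fun w => fejer w * g w)) ->
  (forall w, - D <= g w) ->
  (forall w, w \in `]- (16 / 3), 16 / 3] ->
    e - k * (16 / 3 - (-1) ^+ sgn * w) <= g w) ->
  \int[mu]_w (fejer w * g w) <= eta ->
  e <= k * (16 / 3) + D / 3 + 4 / 3 * (eta / pi).
Proof.
move=> D0 eta0 ig gD gk geta.
have h0 : 0 < 16 / 3 :> R by lra.
have pi3 := @pi_ge3 R; have pi0 := @pi_gt0 R.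
have := le_trans (fejer_lower_bound h0 ig gD gk) geta.
have /andP[] := fejer_mass_ge h0.
(* The half width 16/3 is chosen here: the tails take at most 3/4, and pi - 3/4 >= 3 pi/4 exactly
   when pi >= 3. *)
have -> : 4 / (16 / 3) = 3 / 4 :> R by lra.
move: (fejer_mass _) => m m1 m2 H.
(* The mass may be replaced by its lower bound only under a positive factor; otherwise the claim is
   immediate. *)
have [le0|gt0] := leP (e + D - k * (16 / 3)) 0.
  have : 0 <= eta / pi by rewrite divr_ge0// ltW.
  lra.
have ep : eta = eta / pi * pi by rewrite divfK// gt_eqF.
have : (e + D - k * (16 / 3)) * (3 / 4 * pi) <= (eta / pi + D) * pi.
  rewrite [leRHS]mulrDl -ep; apply: le_trans (_ : (e + D - k * (16 / 3)) * m <= _); last lra.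
  by rewrite ler_pM2l//; lra.
by rewrite mulrA ler_pM2r//; lra.
Qed.

End smoothing.

(** * Esseen's smoothing inequality *)

Section smoothing_inequality.
Context d (T : measurableType d) d' (T' : measurableType d') (R : realType).
Context (P : probability T R) (Q : probability T' R).
Variables (X : {RV P >-> R}) (Y : {RV Q >-> R}).
Local Notation mu := (@lebesgue_measure R).

(* Evaluate the smoothed difference at distance (16/3)/tau from a near-extremal
   point: half width 16/3 leaves at least 3/4 of the mass pi of the kernel, so the
   supremum Del satisfies Del <= (16/3) L/tau + Del/3 + (4/3) eta/pi. *)
Lemma smoothing_inequality (L tau eta : R) : 0 < tau -> 0 <= L ->
  P.-integrable setT (EFin \o X) -> Q.-integrable setT (EFin \o Y) ->
  (forall a b, a <= b -> rcdf Y b - rcdf Y a <= L * (b - a)) ->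
  (forall x, `|\int[mu]_(s in `]0, 1])
    (smooth_kernel X x tau s - smooth_kernel Y x tau s)| <= eta) ->
  forall x, `|rcdf X x - rcdf Y x| <= 8 * L / tau + 2 * eta / pi.
Proof.
move=> tau0 L0 iX iY YL keta.
have eta0 : 0 <= eta by apply: le_trans (keta 0).
pose dist (x : R) : R := `|rcdf X x - rcdf Y x|.
have dist1 x : dist x <= 1.
  have := rcdf_ge0 X x; have := rcdf_le1 X x; have := rcdf_ge0 Y x; have := rcdf_le1 Y x.
  by move=> *; rewrite ler_norml; apply/andP; split; lra.
have hs : has_sup (range dist).
  by split; [exists (dist 0), 0|exists 1 => _ [x _ <-]].
pose Del := sup (range dist).
have distD x : dist x <= Del by apply: sup_upper_bound => //; exists x.
have Del0 : 0 <= Del by apply: le_trans (distD 0); exact: normr_ge0.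
have eint x : \int[mu]_w (fejer w * rcdf X (x - w / tau)) - \int[mu]_w (fejer w * rcdf Y (x - w / tau)) =
    \int[mu]_(s in `]0, 1]) (smooth_kernel X x tau s - smooth_kernel Y x tau s).
  have [iKX ->] := smoothed_cdfE x tau0 iX; have [iKY ->] := smoothed_cdfE x tau0 iY.
  by rewrite RintegralB//; ring.
have iF x := integrable_fejer_cdf X x tau0; have iG x := integrable_fejer_cdf Y x tau0.
have step x : dist x <= L / tau * (16 / 3) + Del / 3 + 4 / 3 * (eta / pi).
  have [YX|XY] := leP (rcdf Y x) (rcdf X x).
    (* Shifting right by half a window puts every point of the window to the right of x, where the
       distribution function of X has not decreased and that of Y has grown at rate at most [L]. *)
    rewrite /dist ger0_norm ?subr_ge0//; pose x' := x + 16 / 3 / tau.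
    have iFG : mu.-integrable setT (EFin \o (fun w => fejer w *
        (rcdf X (x' - w / tau) - rcdf Y (x' - w / tau)))).
      have := integrableB measurableT (iF x') (iG x').
      by apply: eq_integrable => // w _; rewrite /= mulrBr EFinB.
    apply: (@fejer_upper_bound _ _ _ _ _ _ false Del0 eta0 iFG).
    - by move=> w; have := distD (x' - w / tau); rewrite /dist ler_norml => /andP[].
    - move=> w; rewrite in_itv/= expr0 mul1r => /andP[w1 w2].
      have xw : x' - w / tau = x + (16 / 3 - w) / tau by rewrite /x'; ring.
      have hw : 0 <= (16 / 3 - w) / tau by rewrite divr_ge0 ?(ltW tau0)// subr_ge0.
      have xle : x <= x' - w / tau by rewrite xw; lra.
      have := rcdf_le X xle; have := YL _ _ xle; rewrite xw.
      have -> : L * (x + (16 / 3 - w) / tau - x) = L / tau * (16 / 3 - w) by ring.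
      lra.
    - under eq_Rintegral do rewrite mulrBr.
      rewrite (RintegralB measurableT (iF x') (iG x')).
      by rewrite eint; apply: le_trans (keta x'); exact: ler_norm.
  rewrite /dist distrC ger0_norm ?subr_ge0 ?(ltW XY)//; pose x' := x - 16 / 3 / tau.
  have iFG : mu.-integrable setT (EFin \o (fun w => fejer w *
      (rcdf Y (x' - w / tau) - rcdf X (x' - w / tau)))).
    have := integrableB measurableT (iG x') (iF x').
    by apply: eq_integrable => // w _; rewrite /= mulrBr EFinB.
  apply: (@fejer_upper_bound _ _ _ _ _ _ true Del0 eta0 iFG).
  - by move=> w; have := distD (x' - w / tau); rewrite /dist distrC ler_norml => /andP[].
  - move=> w; rewrite in_itv/= expr1 mulN1r opprK => /andP[w1 w2].
    have xw : x' - w / tau = x - (16 / 3 + w) / tau by rewrite /x'; ring.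
    have hw : 0 <= (16 / 3 + w) / tau by rewrite divr_ge0 ?(ltW tau0)//; lra.
    have xle : x' - w / tau <= x by rewrite xw; lra.
    have := rcdf_le X xle; have := YL _ _ xle; rewrite xw.
    have -> : L * (x - (x - (16 / 3 + w) / tau)) = L / tau * (16 / 3 + w) by ring.
    lra.
  - under eq_Rintegral do rewrite mulrBr.
    rewrite (RintegralB measurableT (iG x') (iF x')).
    by rewrite -opprB eint; apply: le_trans (keta x'); rewrite -normrN; exact: ler_norm.
have : Del <= L / tau * (16 / 3) + Del / 3 + 4 / 3 * (eta / pi).
  by apply: ge_sup => [|_ [x _ <-]//]; exists (dist 0), 0.
(* Absorbing Del/3 on the left multiplies the other terms by 3/2, which gives the constants 8 and
   2. *)
move=> h x; apply: le_trans (distD x) _.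
have -> : 8 * L / tau = 3 / 2 * (L / tau * (16 / 3)) by field; rewrite gt_eqF.
have -> : 2 * eta / pi = 3 / 2 * (4 / 3 * (eta / pi)) by move: (pi^-1) => q; lra.
lra.
Qed.

End smoothing_inequality.

(** * Elementary numerical inequalities and series tails *)

Section elementary_bounds.
Context {R : realType}.

(** exp(- 1/6) >= 5/6, and the sixth power of 5/6 is just above 1/3. *)
Lemma expR1_le3 : expR 1 <= 3 :> R.
Proof.
have h : 5 / 6 <= expR (- (1 / 6)) :> R by have := @expR_ge1Dx R (- (1 / 6)); lra.
have : (5 / 6) ^+ 6 <= expR (- (1 / 6)) ^+ 6 :> R by apply: lerXn2r => //; rewrite nnegrE; lra.
rewrite -expRM_natl; have -> : 6%:R * - (1 / 6) = - 1 :> R by field.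
rewrite expRN => h1; have h2 : 3^-1 <= (expR 1)^-1 :> R by apply: le_trans h1; lra.
by move: h2; rewrite lef_pV2// ?posrE ?expR_gt0 ?ltr0n.
Qed.

(** A Stirling bound with 3 in place of e: consecutive left sides have ratio (1 + 1/r)^(r-2) <= e.
    The constant 54 makes r = 3 an equality. *)
Lemma natrX_fact_bound r : (3 <= r)%N ->
  r%:R ^+ (r - 2) / r`!%:R <= 3 ^+ r / 54 :> R.
Proof.
elim: r => // r IH; rewrite leq_eqVlt => /predU1P[<-|r3].
  by rewrite !factS fact0; lra.
have r3' : (3 <= r)%N by [].
have r0 : 0 < r%:R :> R by rewrite ltr0n (leq_trans _ r3').
have {}IH := IH r3'.
have step : r.+1%:R ^+ (r - 2) <= 3 * r%:R ^+ (r - 2) :> R.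
  rewrite -ler_pdivrMr ?exprn_gt0// -expr_div_n.
  have -> : r.+1%:R / r%:R = 1 + r%:R^-1 :> R by rewrite -natr1 mulrDl divff ?gt_eqF// mul1r.
  apply: le_trans expR1_le3.
  have h1 : (1 + r%:R^-1) ^+ (r - 2) <= expR (r%:R^-1) ^+ (r - 2) :> R.
    by apply: lerXn2r; rewrite ?nnegrE ?expR_ge0 ?expR_ge1Dx// addr_ge0// invr_ge0 ltW.
  apply: le_trans h1 _; rewrite -expRM_natl ler_expR ler_pdivrMr// mul1r ler_nat.
  exact: leq_subr.
have -> : r.+1%:R ^+ (r.+1 - 2) / (r.+1)`!%:R = r.+1%:R ^+ (r - 2) / r`!%:R :> R.
  rewrite subSn ?(leq_trans _ r3')// exprS factS natrM; field.
  by rewrite addrC natr1 !pnatr_eq0 -lt0n fact_gt0.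
apply: (@le_trans _ _ (3 * (r%:R ^+ (r - 2) / r`!%:R))).
  by rewrite mulrA ler_wpM2r// invr_ge0.
by rewrite exprS; lra.
Qed.

Lemma norm_sinB_le (x w : R) : `|sin (x - w) - sin x| <= `|w|.
Proof.
have -> : sin (x - w) - sin x = - (2 * (cos (x - w / 2) * sin (w / 2))).
  have {1}-> : x - w = (x - w / 2) - w / 2 by field.
  have {2}-> : x = (x - w / 2) + w / 2 by field.
  by move: (x - w / 2) => p; move: (w / 2) => q; rewrite sinB sinD; ring.
rewrite normrN normrM (ger0_norm (_ : 0 <= 2))// normrM.
have := norm_sin_le (w / 2); rewrite normrM (ger0_norm (_ : 0 <= 2^-1))//.
have : `|cos (x - w / 2)| <= 1 by rewrite ler_norml cos_geN1 cos_le1.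
have := normr_ge0 (sin (w / 2)); have := normr_ge0 (cos (x - w / 2)).
by move: `|_| `|_| `|_| => c s v c0 s0 c1; nra.
Qed.

Lemma norm_expRB1_le (u : R) : `|expR u - 1| <= `|u| * expR `|u|.
Proof.
have [u0|u0] := leP 0 u.
  have e1 : 1 <= expR u by rewrite -expR0 ler_expR.
  have := expR_ge1Dx (- u); rewrite expRN => h.
  rewrite ger0_norm ?subr_ge0// ger0_norm//.
  by have := mulVf (lt0r_neq0 (expR_gt0 u)); have := expR_gt0 u; nra.
rewrite distrC ger0_norm ?subr_ge0 ?expR_le1 ?(ltW u0)// ltr0_norm//.
have : 1 <= expR (- u) by rewrite -expR0 ler_expR oppr_ge0 ltW.
by have := expR_ge1Dx u; nra.
Qed.

(** The left side is the imaginary part of e^(ix) (e^h - 1) with h = u - iw, and |e^h - 1| <= |h|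
    e^|h|; here |u| + |w| stands in for |h|. *)
Lemma rotation_perturbation (u w x E : R) : `|u| + `|w| <= E ->
  `|expR u * sin (x - w) - sin x| <= E * expR E.
Proof.
move=> uwE.
have -> : expR u * sin (x - w) - sin x =
  (expR u - 1) * sin (x - w) + (sin (x - w) - sin x) by ring.
have s1 : `|sin (x - w)| <= 1 by rewrite ler_norml sin_geN1 sin_le1.
have e1 : expR `|u| <= expR E.
  by rewrite ler_expR; apply: le_trans uwE; rewrite lerDl.
have e2 : 1 <= expR E.
  by rewrite -expR0 ler_expR; apply: le_trans uwE; rewrite addr_ge0.
apply: le_trans (ler_normD _ _) _.
apply: (@le_trans _ _ (`|u| * expR E + `|w| * expR E)); last first.
  by rewrite -mulrDl ler_wpM2r ?expR_ge0.
apply: lerD; last first.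
  by apply: le_trans (norm_sinB_le _ _) _; rewrite ler_peMr.
rewrite normrM; apply: (@le_trans _ _ (`|expR u - 1| * 1)); first exact: ler_wpM2l.
rewrite mulr1; apply: le_trans (norm_expRB1_le _) _.
by rewrite ler_wpM2l.
Qed.

Lemma pseries3 (h : nat -> R) (t : R) :
  pseries h t 3 = h 0%N + h 1%N * t + h 2%N * t ^+ 2.
Proof.
by rewrite /pseries /series /= big_mkord !big_ord_recr big_ord0 /= add0r expr0 mulr1 expr1.
Qed.

(** The two tails are bounded jointly: for the real and imaginary parts of one series, each index
    feeds only one of them, so no factor 2 is lost. *)
Lemma psum_tail (f g : nat -> R) (x y q K : R) : coef_bounded f x ->
  coef_bounded g x -> `|y| < x -> 0 <= q < 1 ->
  (forall r, (3 <= r)%N -> (`|f r| + `|g r|) * `|y| ^+ r <= K * q ^+ r) ->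
  `|psum f y - pseries f y 3| + `|psum g y - pseries g y 3| <=
    K * (q ^+ 3 / (1 - q)).
Proof.
move=> fx gx yx /andP[q0 q1] fgK.
have K0 : 0 <= K * q ^+ 3 by apply: le_trans (fgK 3%N _) => //; rewrite mulr_ge0 ?addr_ge0.
have cvB (h : nat -> R) : coef_bounded h x ->
    `|pseries h y n - pseries h y 3| @[n --> \oo] --> `|psum h y - pseries h y 3|.
  by move=> hx; apply: cvg_norm; apply: cvgB; [exact: cvg_psum hx yx|exact: cvg_cst].
have cv := cvgD (FF := eventually_filter) (cvB _ fx) (cvB _ gx).
rewrite -(cvg_lim (@Rhausdorff R) cv); apply: limr_le; first by apply/cvg_ex; eexists; exact: cv.
exists 3%N => // n /= n3.
have E (h : nat -> R) : pseries h y n - pseries h y 3 = \sum_(3 <= i < n) h i * y ^+ i.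
  by rewrite sub_series_geq.
rewrite -[leLHS]/(`|pseries f y n - pseries f y 3| + `|pseries g y n - pseries g y 3|) !E; apply: le_trans (lerD (ler_norm_sum _ _ _) (ler_norm_sum _ _ _)) _.
rewrite -big_split /=; apply: (@le_trans _ _ (\sum_(3 <= i < n) K * q ^+ i)).
  rewrite !big_nat; apply: ler_sum => i /andP[i3 _].
  by rewrite !normrM normrX -mulrDl; exact: fgK.
rewrite -mulr_sumr -(subnKC n3) geometric_partial_tail geometric_seriesE ?lt_eqF//=.
have qn : 0 <= q ^+ (n - 3) by exact: exprn_ge0.
have : 0 <= K * q ^+ 3 / (1 - q) * q ^+ (n - 3).
  by rewrite mulr_ge0// divr_ge0// subr_ge0 ltW.
lra.
Qed.

End elementary_bounds.

(** * Lipschitz bound for the normal distribution function *)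

Section normal_cdf.
Context {R : realType}.
Local Notation mu := (@lebesgue_measure R).
Local Notation nu := (normal_prob (0 : R) 1).

(** By pi >= 3 the peak is at most 1/sqrt 6 < 0.41. *)
Lemma normal_peak1_le : normal_peak 1 <= 41 / 100 :> R.
Proof.
have p3 := @pi_ge3 R; rewrite /normal_peak expr1n mul1r.
have h : 100 / 41 <= Num.sqrt (pi *+ 2) :> R.
  rewrite -[leLHS]ger0_norm; last lra.
  by rewrite -sqrtr_sqr ler_sqrt; rewrite mulr2n; lra.
apply: le_trans (_ : (100 / 41)^-1 <= _); last lra.
by rewrite lef_pV2// posrE; lra.
Qed.

Lemma rcdf_normal_lipschitz (a b : R) : a <= b ->
  rcdf (@normal_id R) b - rcdf (@normal_id R) a <= 41 / 100 * (b - a).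
Proof.
move=> ab.
pose F c : set (measurableTypeR R) := [set w | normal_id w <= c].
have m_ c : measurable (F c) := @measurable_le_set _ _ R nu normal_id c.
have E : (nu `]a, b]%classic = nu (F b) - nu (F a))%E.
  have -> : nu (F a) = nu (F b `&` F a).
    by congr (nu _); rewrite setIidr// => w /= /le_trans; apply.
  rewrite -measureD//; last first.
    by apply: le_lt_trans (probability_le1 _ (m_ b)) _; rewrite ltry.
  congr (nu _); apply/seteqP; split => w /=; rewrite in_itv/=.
    by move=> /andP[aw wb]; split => //; apply/negP; rewrite -ltNge.
  by move=> [wb /negP]; rewrite -ltNge => aw; apply/andP; split.
have -> : rcdf (@normal_id R) b - rcdf (@normal_id R) a = fine (nu `]a, b]%classic).
  by rewrite E fineB// fin_num_measure.
rewrite -lee_fin fineK ?fin_num_measure//.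
apply: (@le_trans _ _ (\int[mu]_(x in `]a, b]) (cst (41 / 100)%:E x))%E).
  apply: ge0_le_integral => //.
  - by move=> x _; rewrite lee_fin normal_pdf_ge0.
  - by apply/measurable_EFinP; apply: measurable_funTS; exact: measurable_normal_pdf.
  - move=> x _; rewrite lee_fin; apply: le_trans normal_peak1_le.
    by apply: normal_pdf_ub; rewrite oner_eq0.
rewrite (_ : integral _ _ _ = (41 / 100)%:E * mu `]a, b]%classic)%E; last exact: integral_cst.
rewrite lebesgue_measure_itv/= lte_fin; case: ltP => [_|_].
  by rewrite -EFinB -EFinM.
by rewrite mule0 lee_fin mulr_ge0// subr_ge0.
Qed.

End normal_cdf.

(** * The characteristic function under cumulant bounds *)

Section cumulant_bounds.
Context d (T : measurableType d) (R : realType) (P : probability T R).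
Variable X : {RV P >-> R}.

(** [u] and [w] are the real and imaginary parts at it of the cumulant series from order three on.
    Order one vanishes by centering, and order two is the Gaussian exponent. *)
Lemma charfun_cumulant_bound (D N A t : R) : 0 < D -> 0 < N -> 0 < A -> 0 <= t ->
  mgf_cvg_near0 X -> ('E_P[X] = 0)%E ->
  (forall r, (2 <= r)%N -> `|cumulant X r| <=
     N * r%:R ^+ (r - 2) * (2 * D) ^+ (r - 1) * A ^+ r) ->
  let q := 6 * D * A * t in q < 1 ->
  exists u w, [/\
    \int[P]_v cos (t * X v) = expR (- (cumulant X 2 * t ^+ 2) / 2 + u) * cos w,
    \int[P]_v sin (t * X v) = expR (- (cumulant X 2 * t ^+ 2) / 2 + u) * sin w &
    `|u| + `|w| <= N / (108 * D) * (q ^+ 3 / (1 - q))].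
Proof.
move=> D0 N0 A0 t0 mX cX kX q q1.
have q0 : 0 <= q.
  by rewrite /q !mulr_ge0 ?(ltW D0) ?(ltW A0).
pose b := egf (cumulant X); pose x := (6 * D * A)^-1.
have DA0 : 0 < 6 * D * A by rewrite !mulr_gt0.
have x0 : 0 < x by rewrite invr_gt0.
have ba : exp_rel b (mcoef X) by exact: cumulant_exp_rel.
(* The bound 3^r/54 on r^(r-2)/r! turns the base 2 D A y into 6 D A y and the prefactor N/(2 D) into
   N/(108 D). *)
have bE r (y : R) : (3 <= r)%N -> 0 <= y ->
    `|b r| * y ^+ r <= N / (108 * D) * (6 * D * A * y) ^+ r.
  move=> r3 y0; have r2 : (2 <= r)%N by exact: leq_trans r3.
  have -> : b r = cumulant X r / r`!%:R by rewrite /b /egf; case: r r3 {r2}.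
  rewrite normrM [`|_^-1|]ger0_norm ?invr_ge0//.
  have := kX r r2 => h.
  have rp : 0 < r`!%:R :> R by rewrite ltr0n fact_gt0.
  apply: (@le_trans _ _ (N / (2 * D) * (r%:R ^+ (r - 2) / r`!%:R) * (2 * D * A * y) ^+ r)).
    have -> : N / (2 * D) * (r%:R ^+ (r - 2) / r`!%:R) * (2 * D * A * y) ^+ r =
      N * r%:R ^+ (r - 2) * (2 * D) ^+ (r - 1) * A ^+ r / r`!%:R * y ^+ r.
      case: r {r3 h rp} r2 => [|[|r]]// _; rewrite subn2 subn1/=.
      have p0 : 2 * D != 0 by rewrite mulf_neq0 ?gt_eqF.
      move: (2 * D) p0 => p p0; rewrite !exprMn [in LHS](exprS p r.+1).
      by field; rewrite p0/= pnatr_eq0 -lt0n fact_gt0.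
    by rewrite ler_wpM2r ?exprn_ge0// ler_wpM2r ?invr_ge0.
  apply: (@le_trans _ _ (N / (2 * D) * (3 ^+ r / 54) * (2 * D * A * y) ^+ r)).
    rewrite ler_wpM2r ?exprn_ge0 ?mulr_ge0 ?(ltW D0) ?(ltW A0)//.
    by rewrite ler_wpM2l ?divr_ge0 ?mulr_ge0 ?(ltW D0) ?(ltW N0)// natrX_fact_bound.
  have -> : 6 * D * A * y = 3 * (2 * D * A * y) by ring.
  move: (2 * D * A * y) => z; rewrite exprMn le_eqVlt; apply/orP; left; apply/eqP.
  by field; rewrite gt_eqF.
have bx : coef_bounded b x.
  exists (`|b 0%N| + `|b 1%N| * x + `|b 2%N| * x ^+ 2 + N / (108 * D)) => r.
  have C0 : 0 <= N / (108 * D) by rewrite divr_ge0 ?mulr_ge0 ?(ltW D0) ?(ltW N0).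
  have b0 := normr_ge0 (b 0%N).
  have b1 : 0 <= `|b 1%N| * x by rewrite mulr_ge0 ?(ltW x0).
  have b2 : 0 <= `|b 2%N| * x ^+ 2 by rewrite mulr_ge0 ?exprn_ge0 ?(ltW x0).
  case: r => [|[|[|r]]]; rewrite ?expr0 ?expr1; try lra.
  have := @bE r.+3 x erefl (ltW x0); rewrite mulfV ?gt_eqF// expr1n mulr1; lra.
have tx : `|t| < x by rewrite ger0_norm// /x -[ltRHS]mul1r ltr_pdivlMr// mulrC.
have [m1 m2] := charfun_exp_rel ba (mgf_cvg_near0_exp_integrable mX) bx tx.
pose f r := b r * reI r : R; pose g r := b r * imI r : R.
have fx : coef_bounded f x.
  by apply: coef_boundedW bx => // [|r]; rewrite ?(ltW x0)// normrM ler_piMr// reI_le1.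
have gx : coef_bounded g x.
  by apply: coef_boundedW bx => // [|r]; rewrite ?(ltW x0)// normrM ler_piMr// imI_le1.
have b0 : b 0%N = 0 by [].
have b1 : b 1%N = 0.
  have [_ a0 /(_ 0%N)] := ba.
  rewrite /conv /pseries_diffs big_ord_recr big_ord0/= a0 add0r !mul1r mulr1 => <-.
  by rewrite /mcoef /Rintegral; under eq_integral do rewrite expr1; move: cX; rewrite unlock => ->; rewrite mul0r.
have b2 : b 2%N = cumulant X 2 / 2 by [].
have f3 : pseries f t 3 = - (cumulant X 2 * t ^+ 2) / 2.
  by rewrite pseries3 /f b0 b1 b2 /reI /= expr1; ring.
have g3 : pseries g t 3 = 0.
  by rewrite pseries3 /g b0 b1 /imI /=; ring.
exists (psum f t - pseries f t 3), (psum g t - pseries g t 3).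
suff h : `|psum f t - pseries f t 3| + `|psum g t - pseries g t 3| <=
    N / (108 * D) * (q ^+ 3 / (1 - q)).
  by rewrite -f3 g3 subr0 addrC subrK; split => //; move: h; rewrite g3 subr0.
apply: (@psum_tail R f g x t q _ fx gx tx); first by apply/andP.
move=> r r3; rewrite (ger0_norm t0).
(* By parity one of [reI r], [imI r] is 0 and the other is a sign. *)
have -> : `|f r| + `|g r| = `|b r|.
  rewrite /f /g /reI /imI !normrM -mulrDr !normr_sign !mulr1.
  by case: (odd r); rewrite /= normr1 normr0 ?addr0 ?add0r mulr1.
exact: bE.
Qed.

End cumulant_bounds.

(** Gives up one factor t and half of the exponent to reach a function with an elementary primitive;
    t exp(- t^2/8) <= 3/2 follows from e^y >= 1 + y. *)
Lemma gauss_moment_le (R : realType) (t : R) : 0 <= t ->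
  t ^+ 2 * expR (- t ^+ 2 / 4) <= 3 / 2 * (t * expR (- t ^+ 2 / 8)).
Proof.
move=> t0; have -> : - t ^+ 2 / 4 = - t ^+ 2 / 8 + - t ^+ 2 / 8 by field.
rewrite expRD; have := expR_ge1Dx (t ^+ 2 / 8); have := expR_gt0 (- t ^+ 2 / 8).
have : expR (- t ^+ 2 / 8) * expR (t ^+ 2 / 8) = 1.
  by rewrite -expRD mulNr addNr expR0.
move: (expR _) (expR _) => f e ef e0 f1.
have h : t * e <= 3 / 2.
  have : t <= 3 / 2 * f by have := sqr_ge0 (t - 8 / 3); lra.
  by move=> /(ler_wpM2r (ltW e0)); lra.
have te : 0 <= t * e by rewrite mulr_ge0// ltW.
have -> : t ^+ 2 * (e * e) = t * e * (t * e) by ring.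
by rewrite ler_wpM2r.
Qed.

(** * Comparison of the rescaled variable with the normal law *)

Section smooth_kernel_bounds.
Context d (T : measurableType d) (R : realType) (P : probability T R).
Variables (X Y : {RV P >-> R}) (D N A s : R).
Hypotheses (D0 : 0 < D) (N0 : 0 < N) (A0 : 0 < A) (s0 : 0 < s).
Hypothesis YX : forall v, Y v = X v / s.
Hypothesis mX : mgf_cvg_near0 X.
Hypothesis cX : ('E_P[X] = 0)%E.
Hypothesis s2 : s ^+ 2 = cumulant X 2.
Hypothesis kX : forall r, (2 <= r)%N -> `|cumulant X r| <=
  N * r%:R ^+ (r - 2) * (2 * D) ^+ (r - 1) * A ^+ r.
Local Notation mu := (@lebesgue_measure R).

(* With sigma = s / sqrt(N D) this is A^3 / sigma^3 * sqrt(D / N). *)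
Let delta := N * D ^+ 2 * A ^+ 3 / s ^+ 3.

Let tau := (20 * delta)^-1.

Let delta0 : 0 < delta. Proof. by rewrite divr_gt0 ?mulr_gt0 ?exprn_gt0. Qed.

(** At frequency t = u tau the characteristic function of Y is the normal one times exp(p + iw), so
    the kernels differ by (1 - u)/u * exp(- t^2/2) times a quantity handled by
    [rotation_perturbation]. *)
Lemma smooth_kernel_diff_le (x u : R) : 0 < u <= 1 ->
  `|smooth_kernel Y x tau u - smooth_kernel (@normal_id R) x tau u| <=
    3 * delta * (tau * ((u * tau) * expR (- (u * tau) ^+ 2 / 8))).
Proof.
move=> /andP[u0 u1]; set t := u * tau.
have t0 : 0 < t by rewrite mulr_gt0// invr_gt0 mulr_gt0.
have dt : delta * t = u / 20 by rewrite /t /tau; field; rewrite gt_eqF.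
have dT : delta * tau = 1 / 20 by rewrite /tau; field; rewrite gt_eqF.
pose q := 6 * D * A * (t / s).
have ts0 : 0 < t / s by rewrite divr_gt0.
have DA0 : 0 < 6 * D * A by rewrite !mulr_gt0.
have q0 : 0 <= q by exact: mulr_ge0 (ltW DA0) (ltW ts0).
have qu : q <= 3 / 5 * u.
  (* The bound at r = 2 limits the variance from above; it is what compares [q] with 12 delta t. *)
  have k2 : s ^+ 2 <= 2 * (N * D * A ^+ 2).
    have := kX (leqnn 2); rewrite -s2 ger0_norm ?exprn_ge0 ?(ltW s0)// subnn expr0.
    by rewrite subn1/= expr1; lra.
  have -> : 3 / 5 * u = 12 * (delta * t) by rewrite dt; field.
  have -> : 12 * (delta * t) = q * (2 * (N * D * A ^+ 2) / s ^+ 2).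
    by rewrite /q /delta; field; rewrite gt_eqF.
  by rewrite -[leLHS]mulr1 ler_wpM2l// ler_pdivlMr ?exprn_gt0// mul1r.
have q1 : q < 1 by lra.
have [p [w [hc hs pw]]] : exists p w, [/\
    \int[P]_v cos (t * Y v) = expR (- t ^+ 2 / 2 + p) * cos w,
    \int[P]_v sin (t * Y v) = expR (- t ^+ 2 / 2 + p) * sin w &
    `|p| + `|w| <= N / (108 * D) * (q ^+ 3 / (1 - q))].
  have [p [w [h1 h2 h3]]] := charfun_cumulant_bound D0 N0 A0
    (divr_ge0 (ltW t0) (ltW s0)) mX cX kX q1.
  have E : - (cumulant X 2 * (t / s) ^+ 2) / 2 = - t ^+ 2 / 2.
    by rewrite -s2; field; rewrite gt_eqF.
  exists p, w; split=> //.
  - by rewrite -E -h1; apply: eq_Rintegral => v _; rewrite YX mulrA mulrAC.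
  - by rewrite -E -h2; apply: eq_Rintegral => v _; rewrite YX mulrA mulrAC.
have [nc ns] : \int[normal_prob 0 1]_v cos (t * normal_id v) = expR (- t ^+ 2 / 2) /\
  \int[normal_prob 0 1]_v sin (t * normal_id v) = 0 := charfun_normal t.
rewrite /smooth_kernel -/t hc hs nc ns.
set E := _ * (_ / _) in pw.
have eE : E = u / 10 * (t ^+ 2 / (1 - q)).
  transitivity (2 * (delta * t) * (t ^+ 2 / (1 - q))); last by rewrite dt; field; lra.
  rewrite /E; move: (1 - q)^-1 => i; rewrite /delta /q; field.
  by rewrite !gt_eqF.
have n : 1 - q != 0 by rewrite gt_eqF// subr_gt0.
have -> : (1 - u) / u * (sin (t * x) * (expR (- t ^+ 2 / 2 + p) * cos w) -
    cos (t * x) * (expR (- t ^+ 2 / 2 + p) * sin w)) -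
    (1 - u) / u * (sin (t * x) * expR (- t ^+ 2 / 2) - cos (t * x) * 0) =
    (1 - u) / u * (expR (- t ^+ 2 / 2) * (expR p * sin (t * x - w) - sin (t * x))).
  by rewrite sinB expRD; ring.
(* Since q <= 3 u/5, it is enough that u/10 <= (1 - 3 u/5)/4, an equality at u = 1. *)
have E4 : E <= t ^+ 2 / 4.
  rewrite eE mulrA ler_pdivrMr ?subr_gt0//.
  have := exprn_ge0 2 (ltW t0); nra.
(* The factor u in [E] cancels 1/u, and the triangle weight 1 - u pays for 1/(1 - q) because q <=
   u. *)
have uE : (1 - u) / u * E <= 2 * delta * tau * t ^+ 2.
  have -> : 2 * delta * tau * t ^+ 2 = t ^+ 2 / 10 by rewrite -[2 * delta * tau]mulrA dT; field.
  have -> : (1 - u) / u * E = (1 - u) / (1 - q) * (t ^+ 2 / 10).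
    by rewrite eE; field; rewrite n gt_eqF.
  rewrite ler_piMl// ?divr_ge0 ?exprn_ge0 ?(ltW t0)//.
  by rewrite ler_pdivrMr ?subr_gt0//; lra.
have E0 : 0 <= E by apply: le_trans pw; rewrite addr_ge0.
have u10 : 0 <= (1 - u) / u by rewrite divr_ge0 ?subr_ge0 ?(ltW u0).
rewrite normrM (ger0_norm u10) normrM (ger0_norm (expR_ge0 _)).
apply: (@le_trans _ _ ((1 - u) / u * (expR (- t ^+ 2 / 2) * (E * expR (t ^+ 2 / 4))))).
  rewrite ler_wpM2l// ler_wpM2l ?expR_ge0//.
  apply: le_trans (rotation_perturbation _ pw) _.
  by rewrite ler_wpM2l// ler_expR.
have -> : (1 - u) / u * (expR (- t ^+ 2 / 2) * (E * expR (t ^+ 2 / 4))) =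
    (1 - u) / u * E * expR (- t ^+ 2 / 4).
  rewrite [RHS](_ : _ = (1 - u) / u * E * (expR (- t ^+ 2 / 2) * expR (t ^+ 2 / 4))); first by ring.
  by rewrite -expRD; congr (_ * expR _); field.
apply: (@le_trans _ _ (2 * delta * tau * t ^+ 2 * expR (- t ^+ 2 / 4))).
  by rewrite ler_wpM2r ?expR_ge0.
have := gauss_moment_le (ltW t0) => g.
have dt0 : 0 <= 2 * (delta * tau) by rewrite dT; lra.
have := ler_wpM2l dt0 g.
lra.
Qed.

Let integrable_Y : P.-integrable setT (EFin \o Y).
Proof.
have := integrableZl measurableT s^-1 (integrable_mgf_cvg_near0 mX).
by apply: eq_integrable => // v _; rewrite /= YX mulrC EFinM.
Qed.

(** In the variable t = u tau the primitive is - 4 exp(- t^2/8), so the bound does not depend on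
    tau. *)
Let integral_gauss_moment : (\int[mu]_(u in `[0%R, 1%R])
  (tau * ((u * tau) * expR (- (u * tau) ^+ 2 / 8)))%:E <= 4%:E)%E.
Proof.
pose F (u : R) := - 4 * expR (- (u * tau) ^+ 2 / 8).
pose f (u : R) := tau * ((u * tau) * expR (- (u * tau) ^+ 2 / 8)).
pose e (u : R) := expR (- (u * tau) ^+ 2 / 8).
have de (u : R) : is_derive u 1 e (e u * (- (u * tau * tau) / 4)).
  have h : is_derive u 1 (fun u : R => - (u * tau) ^+ 2 / 8) (- (u * tau * tau) / 4).
    have h1 := is_derive1M (is_derive_id u 1) (is_derive_cst tau u 1).
    have h2 := is_derive1M (is_deriveN (is_derive1M h1 h1)) (is_derive_cst (8^-1 : R) u 1).
    by apply: is_derive_eq h2 _ => /=; field.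
  exact: is_derive1_comp (is_derive_expR _) h.
have Fd (u : R) : is_derive u 1 F (f u).
  apply: is_derive_eq (is_derive1M (is_derive_cst (- 4 : R) u 1) (de u)) _.
  by rewrite /f -/(e u) /=; move: (e u) => c; field.
have cf : continuous f.
  move=> u; apply: cvgM; first exact: cvg_cst.
  apply: cvgM; last exact: (is_derive_continuous de).
  by apply: cvgM; [exact: cvg_id|exact: cvg_cst].
rewrite (FTC2_is_derive ler01 Fd cf) lee_fin /F mul0r expr0n/= oppr0 mul0r expR0.
have := expR_ge0 (- (1 * tau) ^+ 2 / 8); lra.
Qed.

Lemma smooth_kernel_diff_integral (x : R) : `|\int[mu]_(u in `]0, 1])
  (smooth_kernel Y x tau u - smooth_kernel (@normal_id R) x tau u)| <= 12 * delta.
Proof.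
have tau0 : 0 < tau by rewrite invr_gt0 mulr_gt0.
have mA : measurable (`]0, 1]%classic : set (measurableTypeR R)) by exact: measurable_itv.
have [iY _] := smoothed_cdfE x tau0 integrable_Y.
have [iZ _] := smoothed_cdfE x tau0 (integrable_mgf_cvg_near0 (@mgf_cvg_near0_normal R)).
have iYZ : mu.-integrable `]0, 1] (EFin \o (fun u =>
    smooth_kernel Y x tau u - smooth_kernel (@normal_id R) x tau u)).
  by have := integrableB mA iY iZ; apply: eq_integrable.
pose f (u : R) := tau * ((u * tau) * expR (- (u * tau) ^+ 2 / 8)).
have f0 u : 0 <= u -> 0 <= f u.
  by move=> u0; rewrite /f !mulr_ge0 ?expR_ge0 ?(ltW tau0).
have mf : measurable_fun setT f.
  apply: measurable_funM => //; apply: measurable_funM; first exact: measurable_funM.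
  apply: measurableT_comp => //; apply: measurable_funM => //.
  by apply: measurableT_comp => //; apply: measurable_funX; exact: measurable_funM.
rewrite -lee_fin; apply: (@le_trans _ _ (\int[mu]_(u in `]0%R, 1%R]) ((3 * delta) * f u)%:E)%E).
  apply: (@le_trans _ _ (\int[mu]_(u in `]0%R, 1%R]) `|smooth_kernel Y x tau u - smooth_kernel (@normal_id R) x tau u|%:E)%E).
    rewrite /Rintegral -fine_abse ?integrable_fin_num// fineK; last first.
      by rewrite abse_fin_num integrable_fin_num.
    by apply: le_abse_integral => //; exact: (measurable_int mu).
  apply: ge0_le_integral => //.
  - apply/measurable_EFinP; apply: measurableT_comp => //.
    by apply/measurable_EFinP; exact: (measurable_int mu).
  - by apply/measurable_EFinP; apply: measurable_funM => //; exact: measurable_funTS.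
  - by move=> u; rewrite /= in_itv/= => u01; rewrite lee_fin; exact: smooth_kernel_diff_le.
under eq_integral do rewrite EFinM.
rewrite ge0_integralZl//=; last 3 first.
- by apply/measurable_EFinP; exact: measurable_funTS.
- by move=> u; rewrite in_itv/= => /andP[u0 _]; rewrite lee_fin f0// ltW.
- by rewrite lee_fin mulr_ge0// ltW.
rewrite integral_itv_obnd_cbnd; last by apply/measurable_EFinP; exact: measurable_funTS.
apply: (@le_trans _ _ ((3 * delta)%:E * 4%:E)%E).
  by rewrite lee_wpmul2l ?integral_gauss_moment// lee_fin mulr_ge0// ltW.
by rewrite -EFinM lee_fin; lra.
Qed.

Lemma rcdf_normal_dist (x : R) :
  `|rcdf Y x - rcdf (@normal_id R) x| <= 7636 / 100 * delta.
Proof.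
have tau0 : 0 < tau by rewrite invr_gt0 mulr_gt0.
have L0 : 0 <= 41 / 100 :> R by lra.
apply: le_trans (smoothing_inequality tau0 L0 integrable_Y
  (integrable_mgf_cvg_near0 (@mgf_cvg_near0_normal R)) (@rcdf_normal_lipschitz R)
  smooth_kernel_diff_integral x) _.
(* The Lipschitz term gives 8 * 0.41 * 20 = 65.6; with the spectral term 24/pi <= 8 the sum 73.6
   stays below 76.36. *)
have -> : 8 * (41 / 100) / tau = 328 / 5 * delta.
  by rewrite /tau invrK; field.
have h : 2 * (12 * delta) / pi <= 8 * delta.
  rewrite ler_pdivrMr ?pi_gt0//.
  by have := ler_wpM2l (ltW delta0) (@pi_ge3 R); move: pi delta => p e; lra.
apply: (le_trans (lerD (lexx _) h)); rewrite -mulrDl ler_wpM2r ?(ltW delta0)//; lra.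
Qed.

End smooth_kernel_bounds.

Theorem corollary30 (R : realType) (d : nat -> measure_display)
    (T : forall n, measurableType (d n)) (P : forall n, probability (T n) R)
    (S : forall n, {RV (P n) >-> R}) (D N : nat -> R) (A : R)
    (centered : forall n, ('E_(P n)[S n] = 0)%E)
    (mgf_cvg : forall n, mgf_cvg_near0 (S n))
    (var_gt0 : forall n, (0 < 'V_(P n)[S n])%E)
    (bounds : uniform_cumulant_bounds S D N A)
    (Y : forall n, {RV (P n) >-> R})
    (defY : forall n x, Y n x = S n x / Num.sqrt (fine ('V_(P n)[S n])))
    (sigma : nat -> R) (sigma_gt0 : forall n, 0 < sigma n)
    (sigma_sq : forall n,
      sigma n ^+ 2 = fine ('V_(P n)[S n]) / (N n * D n)) :
  forall n,
    kolmogorov_distance (Y n) (normal_prob 0 1) <=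
      (7636 / 100) * A ^+ 3 / sigma n ^+ 3 * Num.sqrt (D n / N n).
Proof.
move=> n; have [A0 D_gt0 N_gt0 kX] := bounds.
have D0 := D_gt0 n; have N0 := N_gt0 n; have sg0 := sigma_gt0 n.
have V2 := cumulant2 (mgf_cvg n) (centered n).
pose V := fine ('V_(P n)[S n]).
have VE : V = cumulant (S n) 2 by rewrite /V V2.
have V0 : 0 < V by rewrite VE -lte_fin -V2; exact: var_gt0.
pose s := Num.sqrt (V); have s0 : 0 < s by rewrite sqrtr_gt0.
have s2 : s ^+ 2 = V by rewrite sqr_sqrtr// ltW.
have sE : s = sigma n * Num.sqrt (N n * D n).
  apply/eqP; rewrite -(@eqrXn2 _ 2)// ?(ltW s0) ?mulr_ge0 ?(ltW sg0)//.
  rewrite s2 exprMn sqr_sqrtr ?mulr_ge0 ?(ltW N0) ?(ltW D0)// sigma_sq -/V.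
  by rewrite divfK// mulf_neq0 ?gt_eqF.
(* With r = sqrt(N D), sigma = s/r and sqrt(D/N) = r/N, the bound contains r^4/N = N D^2. *)
have -> : 7636 / 100 * A ^+ 3 / sigma n ^+ 3 * Num.sqrt (D n / N n) =
    7636 / 100 * (N n * D n ^+ 2 * A ^+ 3 / s ^+ 3).
  set r := Num.sqrt (N n * D n) in sE.
  have r0 : 0 < r by rewrite sqrtr_gt0 mulr_gt0.
  have r2 : r ^+ 2 = N n * D n by rewrite sqr_sqrtr// mulr_ge0 ?(ltW N0) ?(ltW D0).
  have -> : Num.sqrt (D n / N n) = r / N n.
    apply/eqP; rewrite -(@eqrXn2 _ 2)// ?divr_ge0 ?(ltW r0) ?(ltW N0)//.
    rewrite sqr_sqrtr ?divr_ge0 ?(ltW N0) ?(ltW D0)// expr_div_n r2.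
    by apply/eqP; field; rewrite gt_eqF.
  have -> : s ^+ 3 = sigma n ^+ 3 * (N n * D n * r) by rewrite sE -r2; ring.
  have -> : r / N n = r ^+ 2 / (N n * r) by field; rewrite !gt_eqF.
  by rewrite r2; field; rewrite !gt_eqF.
apply: ge_sup => [|_ [a _ <-]].
  by exists `|rcdf (Y n) 0 - rcdf normal_id 0|, 0.
apply: (rcdf_normal_dist D0 N0 A0 s0 (defY n) (mgf_cvg n) (centered n) _ (kX n)).
by rewrite s2.
Qed.
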